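(* If $\sigma$ is $1$-homogeneous, then for every function $f$ on $\mathcal{X}$, $\|f\|_{\mathcal{B}}=\mathscr{C}^{(2)}(f)$.
   Context: $\mathcal{X} \subset \mathbb{R}^d$ is compact; $\sigma:\mathbb{R}\to\mathbb{R}$ is a fixed activation function, $1$-homogeneous meaning $\sigma(au)=a\sigma(u)$ for all $u\in\mathbb{R}$, $a\ge0$. $\mathcal{P}(U)$ is the set of probability measures on $U$. Barron norm: $\|f\|_{\mathcal{B}}=\inf_\mu\int|a|\,\|z\|\,\mu(da,dz)$, the infimum over all $\mu\in\mathcal{P}(\mathbb{R}\times\mathbb{R}^d)$ such that $f(x)=\int a\,\sigma(z^\top x)\,\mu(da,dz)$ for all $x\in\mathcal{X}$ ($+\infty$ if none exists). For a probability measure $\mu$ on functions on $\mathcal{X}$, put $\kappa_\mu(x,x') = \int \sigma(h(x))\sigma(h(x'))\,\mu(dh)$ (assumed finite), and let $\mathcal{H}_\mu$ be the reproducing kernel Hilbert space (RKHS) on $\mathcal{X}$ with kernel $\kappa_\mu$. $\mathcal{H}^{(1)} = \{x\mapsto z^\top x : z\in\mathbb{R}^d\}$ with the inner product inherited from $\mathbb{R}^d$ (the RKHS of the kernel $x^\top x'$). For $\mu\in\mathcal{P}(\mathcal{H}^{(1)})$, $\|\mu\|_{\mathcal{H}^{(1)},p} = (\int \|h\|_{\mathcal{H}^{(1)}}^p\,\mu(dh))^{1/p}$ for $0<p<\infty$, and $\|\mu\|_{\mathcal{H}^{(1)},\infty}$ is the $\mu$-essential supremum of $\|\cdot\|_{\mathcal{H}^{(1)}}$.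 For an RKHS $\mathcal{H}$ on $\mathcal{X}$, $\mathscr{D}^{(2)}_p(\mathcal{H})=\inf\{\|\mu\|_{\mathcal{H}^{(1)},p}:\mu\in\mathcal{P}(\mathcal{H}^{(1)}),\ \mathcal{H}_\mu=\mathcal{H}\}$, and $\mathscr{C}^{(2)}_p(f)=\inf_{\mathcal{H}}\big(\|f\|_{\mathcal{H}}\,\mathscr{D}^{(2)}_p(\mathcal{H})\big)$ over RKHSs $\mathcal{H}$ on $\mathcal{X}$ (only choices with both factors finite are considered; infimum over the empty set is $+\infty$). For $1$-homogeneous $\sigma$ this is the same for all $p\in[2,\infty]$ and is denoted $\mathscr{C}^{(2)}(f)$. *)

(* Defs.v *)
From HB Require Import structures.
From mathcomp Require Import all_boot all_order all_algebra.
From mathcomp Require Import all_classical all_reals all_analysis.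

Set Implicit Arguments.
Unset Strict Implicit.
Unset Printing Implicit Defensive.

Import Order.TTheory GRing.Theory Num.Theory.
Import numFieldNormedType.Exports.

Local Open Scope classical_set_scope.
Local Open Scope ring_scope.

Definition homogeneous1 (R : realType) (sigma : R -> R) : Prop :=
  forall u a : R, 0 <= a -> sigma (a * u) = a * sigma u.

(* The library norm on 'rV is the sup norm, hence the explicit Euclidean one. *)
Definition dot (R : realType) (d : nat) (z x : 'rV[R]_d) : R :=
  \sum_(i < d) z ord0 i * x ord0 i.

Definition enorm (R : realType) (d : nat) (z : 'rV[R]_d) : R :=
  Num.sqrt (dot z z).

Definition borelRd (R : realType) (d : nat) :=
  g_sigma_algebraType (@open 'rV[R]_d).

Definition barron_represents (R : realType) (d : nat) (X : set 'rV[R]_d)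
    (sigma : R -> R) (f : X -> R)
    (mu : probability (measurableTypeR R * borelRd R d)%type R) : Prop :=
  forall x : X,
    let phi := fun w : measurableTypeR R * borelRd R d =>
      (w.1 * sigma (dot w.2 (val x)))%:E in
    mu.-integrable setT phi /\ (\int[mu]_w phi w = (f x)%:E)%E.

Definition barron_norm (R : realType) (d : nat) (X : set 'rV[R]_d)
    (sigma : R -> R) (f : X -> R) : \bar R :=
  ereal_inf [set (\int[mu]_w (`|w.1| * enorm w.2)%:E)%E |
             mu in barron_represents sigma f].

(* A reproducing kernel Hilbert space on T: a Hilbert space of functions on T
   whose point evaluations are continuous. The values of [rkhs_ip] outside
   [rkhs_mem] are irrelevant. *)
Record rkhs (R : realType) (T : Type) := Rkhs {
  rkhs_mem : set (T -> R) ;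
  rkhs_ip : (T -> R) -> (T -> R) -> R ;
  rkhs_mem0 : rkhs_mem (fun=> 0) ;
  rkhs_memP : forall (a : R) f g, rkhs_mem f -> rkhs_mem g ->
    rkhs_mem (fun x => a * f x + g x) ;
  rkhs_ipC : forall f g, rkhs_mem f -> rkhs_mem g ->
    rkhs_ip f g = rkhs_ip g f ;
  rkhs_ipP : forall (a : R) f g h,
    rkhs_mem f -> rkhs_mem g -> rkhs_mem h ->
    rkhs_ip (fun x => a * f x + g x) h = a * rkhs_ip f h + rkhs_ip g h ;
  rkhs_ip_ge0 : forall f, rkhs_mem f -> 0 <= rkhs_ip f f ;
  rkhs_ip_eq0 : forall f, rkhs_mem f -> rkhs_ip f f = 0 -> f = (fun=> 0) ;
  rkhs_norm := fun f => Num.sqrt (rkhs_ip f f) ;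
  rkhs_complete : forall u : nat -> T -> R,
    (forall n, rkhs_mem (u n)) ->
    (forall e : R, 0 < e -> exists N : nat, forall m n : nat,
      (N <= m)%N -> (N <= n)%N -> rkhs_norm (fun x => u m x - u n x) < e) ->
    exists2 f, rkhs_mem f &
      (fun n => rkhs_norm (fun x => u n x - f x)) @ \oo --> (0 : R) ;
  rkhs_eval : forall x : T, exists C : R,
    forall f, rkhs_mem f -> `|f x| <= C * rkhs_norm f
}.

(* [H] is the RKHS with kernel [k]: by the uniqueness part of the
   Moore-Aronszajn theorem, at most one RKHS has a given reproducing kernel. *)
Definition has_kernel (R : realType) (T : Type) (H : rkhs R T)
    (k : T -> T -> R) : Prop :=
  forall x : T, rkhs_mem H (k x) /\
    forall f, rkhs_mem H f -> f x = rkhs_ip H f (k x).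

Definition linfuns (R : realType) (d : nat) (X : set 'rV[R]_d) :
    set (X -> R) :=
  [set h | exists z : 'rV[R]_d, h = fun x : X => dot z (val x)].

(* The RKHS norm of the kernel [dot] on [X]. When [X] spans R^d it is the
   Euclidean norm of the unique [z] representing [h]; otherwise [z] is only
   determined up to the orthogonal complement of [X], and this is the norm on
   the corresponding quotient of R^d. *)
Definition linfun_norm (R : realType) (d : nat) (X : set 'rV[R]_d)
    (h : X -> R) : R :=
  inf [set enorm z | z in
       [set z : 'rV[R]_d | h = fun x : X => dot z (val x)]].

Definition H1 (R : realType) (d : nat) (X : set 'rV[R]_d) : Type :=
  set_type (@linfuns R d X).

HB.instance Definition _ (R : realType) (d : nat) (X : set 'rV[R]_d) :=
  Choice.on (H1 X).

Lemma linfuns0 (R : realType) (d : nat) (X : set 'rV[R]_d) :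
  (fun=> 0) \in @linfuns R d X.
Proof.
apply/mem_set; exists 0; apply/funext => x.
by rewrite /dot big1// => i _; rewrite mxE mul0r.
Qed.

HB.instance Definition _ (R : realType) (d : nat) (X : set 'rV[R]_d) :=
  isPointed.Build (H1 X) (exist _ (fun=> 0) (linfuns0 X)).

Definition H1_norm (R : realType) (d : nat) (X : set 'rV[R]_d) (h : H1 X) : R :=
  linfun_norm (val h).

Definition H1_open (R : realType) (d : nat) (X : set 'rV[R]_d)
    (U : set (H1 X)) : Prop :=
  forall h : H1 X, U h -> exists2 e : R, 0 < e &
    forall g : H1 X, linfun_norm (fun x => val g x - val h x) < e -> U g.

Definition borelH1 (R : realType) (d : nat) (X : set 'rV[R]_d) :=
  g_sigma_algebraType (@H1_open R d X).

Definition kappa_finite (R : realType) (d : nat) (X : set 'rV[R]_d)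
    (sigma : R -> R) (mu : probability (borelH1 X) R) : Prop :=
  forall x x' : X, mu.-integrable setT
    (fun h : borelH1 X => (sigma (val h x) * sigma (val h x'))%:E).

Definition kappa (R : realType) (d : nat) (X : set 'rV[R]_d)
    (sigma : R -> R) (mu : probability (borelH1 X) R) (x x' : X) : R :=
  \int[mu]_h (sigma (val h x) * sigma (val h x')).

Definition H1_moment (R : realType) (d : nat) (X : set 'rV[R]_d)
    (p : \bar R) (mu : probability (borelH1 X) R) : \bar R :=
  Lnorm mu p (fun h : borelH1 X => (H1_norm h)%:E).

Definition ladder_D2 (R : realType) (d : nat) (X : set 'rV[R]_d)
    (sigma : R -> R) (p : \bar R) (H : rkhs R X) : \bar R :=
  ereal_inf [set H1_moment p mu | mu in
    [set mu : probability (borelH1 X) R |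
      kappa_finite sigma mu /\ has_kernel H (kappa sigma mu)]].

Definition ladder_C2 (R : realType) (d : nat) (X : set 'rV[R]_d)
    (sigma : R -> R) (p : \bar R) (f : X -> R) : \bar R :=
  ereal_inf [set ((rkhs_norm H f)%:E * ladder_D2 sigma p H)%E | H in
    [set H : rkhs R X | rkhs_mem H f /\ (ladder_D2 sigma p H < +oo)%E]].

(* Main.v *)
(* Both sides are compared through a description of the RKHS of a kernel k that
   never mentions L^2: f lies in it with norm at most C iff
   |sum_i c_i f(x_i)| <= C (sum_ij c_i c_j k(x_i, x_j))^(1/2) for all finite
   families (c_i, x_i).

   If mu represents f with cost m = int |a| ||z|| dmu, let nu be the law of the
   direction z / ||z|| under the density (|a| ||z|| + delta) / (m + delta). It is
   carried by the unit ball, so all its moments are at most 1, and 1-homogeneity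
   with the Cauchy-Schwarz inequality gives ||f|| <= m + delta in H_nu.

   Conversely, let f lie in H_nu. Expand f as an absolutely convergent series of
   kernel combinations sum_n F_n with sum_n ||F_n|| <= ||f|| + eps; each F_n is
   x |-> int g_n(h) sigma(h(x)) nu(dh) with ||g_n||_2 = ||F_n||. The mixture with
   weights 2^-(n+1) of the laws under nu of (2^(n+1) g_n(h), z(h)), z(h) being the
   minimal representative of h, represents f with cost at most
   sum_n int |g_n| ||h|| dnu <= (||f|| + eps) ||nu||_2. *)
From HB Require Import structures.
Require Import Defs.
From mathcomp Require Import all_boot all_order all_algebra.
From mathcomp Require Import all_classical all_reals all_analysis.
From mathcomp Require Import measurable_realfun ess_sup_inf.
From mathcomp Require Import ring lra.

Import Order.TTheory GRing.Theory Num.Theory.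
Import numFieldNormedType.Exports.

Local Open Scope classical_set_scope.
Local Open Scope ring_scope.

Set Implicit Arguments.
Unset Strict Implicit.
Unset Printing Implicit Defensive.

(** * The RKHS of a positive semidefinite kernel *)

(** The usual route identifies H_nu with a closed subspace of L^2(nu) and represents f by the g of
    minimal norm there. Working with finite families avoids completeness of L^2(nu): a series of
    explicit features stands in for g, and a countable mixture stands in for the sum of that series.
    The mixture costs nothing because both the represented function and the cost scale with the
    amplitude a, so the factors 2^(n+1) cancel the weights.

    The two directions ask different things of an RKHS. Starting from mu, one has to be built,
    completeness included; its squared norm is available at once as a supremum, and the inner
    product is recovered from it by the Jordan-von Neumann argument. In the converse, H is an
    arbitrary Hilbert space with kernel kappa, so the density of kernel combinations has to be
    derived from the reproducing property and the completeness of H.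

    The identity is proved for each p in [2, +oo] separately: a measure carried by the unit ball
    serves every p at once, and moments of a probability measure increase with p, so the converse
    only needs the second one. *)

(** The discriminant argument shared by all the Cauchy-Schwarz and first-variation steps below: the
    optimal choice is t = a / b. *)
Lemma sqr_le_of_quadratic (R : realFieldType) (a b c : R) :
  0 <= b -> 0 <= c -> (forall t, 2 * t * a - t ^+ 2 * b <= c) -> a ^+ 2 <= c * b.
Proof.
move=> b0 c0 h; have [b00|bn0] := eqVneq b 0.
  have [->|a0] := eqVneq a 0; first by rewrite expr0n/= mulr_ge0.
  (* With b = 0 the bound is linear in t; this t gives 2 (c + 1) <= c, which is absurd for c >=
     0. *)
  have := h ((c + 1) / a); rewrite b00 mulr0 subr0.
  rewrite -mulrA divfK//; lra.
have := h (a / b); rewrite -ler_pdivrMr ?lt0r ?bn0//.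
by have -> : 2 * (a / b) * a - (a / b) ^+ 2 * b = a ^+ 2 / b by field.
Qed.

(* An additive function that is bounded near 0 is linear: subtracting its linear
   part leaves a 1-periodic, hence bounded, additive function. *)
Lemma additive_bounded_linear (R : realType) (phi : R -> R) (C : R) :
  (forall a b, phi (a + b) = phi a + phi b) ->
  (forall a, `|a| <= 1 -> `|phi a| <= C) ->
  forall a, phi a = a * phi 1.
Proof.
move=> phiD phiC.
have phi0 : phi 0 = 0 by have := phiD 0 0; rewrite addr0; lra.
have phiM n a : phi (n%:R * a) = n%:R * phi a.
  elim: n => [|n IH]; first by rewrite !mul0r.
  by rewrite -natr1 !mulrDl !mul1r phiD IH.
have phiN a : phi (- a) = - phi a by have := phiD a (- a); rewrite subrr phi0; lra.
have phi1 (m : int) : phi m%:~R = m%:~R * phi 1.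
  case: m => n; first by rewrite -pmulrn -[X in phi X]mulr1 phiM.
  by rewrite NegzE mulrNz phiN -pmulrn -[X in phi X]mulr1 phiM mulNr.
have bnd a : `|phi a - a * phi 1| <= C + `|phi 1|.
  have /andP[f1 f2] := floor_itv a.
  have -> : phi a = phi (Num.floor a)%:~R + phi (a - (Num.floor a)%:~R).
    by rewrite -phiD addrC subrK.
  rewrite phi1; set m := (Num.floor a)%:~R in f1 f2 *.
  have -> : m * phi 1 + phi (a - m) - a * phi 1
     = phi (a - m) - (a - m) * phi 1 by ring.
  have am : `|a - m| <= 1.
    by move: f2; rewrite intrD -/m ler_norml => f2; apply/andP; split; lra.
  rewrite (le_trans (ler_normB _ _))// lerD ?phiC// normrM.
  by rewrite ler_piMl.
move=> a; apply/eqP; rewrite -subr_eq0; apply/negPn/negP => ne.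
have pos : 0 < `|phi a - a * phi 1| by rewrite normr_gt0.
have [n hn] : exists n : nat, (C + `|phi 1|) / `|phi a - a * phi 1| < n%:R.
  exists (Num.bound `|(C + `|phi 1|) / `|phi a - a * phi 1| |).
  by rewrite (le_lt_trans (ler_norm _))// archi_boundP.
have := bnd (n%:R * a); rewrite phiM -mulrA -mulrBr normrM normr_nat leNgt.
by rewrite -ltr_pdivrMr// hn.
Qed.

Lemma cauchy_seq_cvg (R : realType) (u : nat -> R) :
  (forall e : R, 0 < e -> exists N : nat, forall m n : nat,
     (N <= m)%N -> (N <= n)%N -> `|u m - u n| <= e) -> cvgn u.
Proof.
move=> uc; apply/cauchy_cvgP/cauchy_exP => e e0.
have [N hN] := uc (e / 2) ltac:(lra); exists (u N); exists N => // n /= Nn.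
by rewrite /ball/= (le_lt_trans (hN _ _ _ Nn))//; lra.
Qed.

Section pairing.
Context {R : realType} {T : Type}.
Implicit Types (s t : seq (R * T)) (f g : T -> R) (k : T -> T -> R).

(** A list [s] is read as the finitely supported signed measure sum_i c_i delta_(x_i) and [pairing]
    as integration against it; concatenation is then addition, and [gram k] is the bilinear form
    induced by k. *)
Definition pairing s f : R := \sum_(i <- s) i.1 * f i.2.

Definition scaleseq (a : R) s : seq (R * T) := [seq (a * i.1, i.2) | i <- s].

Definition gram k s t : R := pairing s (fun x => pairing t (k x)).

Definition psd_kernel k :=
  (forall x y, k x y = k y x) /\ forall s, 0 <= gram k s s.

Lemma pairing_nil f : pairing [::] f = 0.
Proof. by rewrite /pairing big_nil. Qed.

Lemma pairing1 a x f : pairing [:: (a, x)] f = a * f x.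
Proof. by rewrite /pairing big_seq1. Qed.

Lemma pairing_cat s t f : pairing (s ++ t) f = pairing s f + pairing t f.
Proof. by rewrite /pairing big_cat. Qed.

Lemma pairing_scale a s f : pairing (scaleseq a s) f = a * pairing s f.
Proof.
by rewrite /pairing big_map mulr_sumr; apply: eq_bigr => i _; rewrite mulrA.
Qed.

Lemma pairingP a s f g :
  pairing s (fun x => a * f x + g x) = a * pairing s f + pairing s g.
Proof.
rewrite /pairing mulr_sumr -big_split; apply: eq_bigr => i _ /=.
by rewrite mulrDr mulrCA.
Qed.

Lemma pairingD s f g : pairing s (fun x => f x + g x) = pairing s f + pairing s g.
Proof. by rewrite /pairing -big_split; apply: eq_bigr => i _; rewrite mulrDr. Qed.

Lemma pairingB s f g : pairing s (fun x => f x - g x) = pairing s f - pairing s g.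
Proof.
by rewrite /pairing -sumrB; apply: eq_bigr => i _; rewrite mulrBr.
Qed.

Lemma pairingZ a s f : pairing s (fun x => a * f x) = a * pairing s f.
Proof. by rewrite /pairing mulr_sumr; apply: eq_bigr => i _; rewrite mulrCA. Qed.

Lemma pairing0 s : pairing s (fun=> 0) = 0.
Proof. by rewrite /pairing big1// => i _; rewrite mulr0. Qed.

Lemma gram_catl k s t u : gram k (s ++ t) u = gram k s u + gram k t u.
Proof. by rewrite /gram pairing_cat. Qed.

Lemma gram_catr k s t u : gram k u (s ++ t) = gram k u s + gram k u t.
Proof.
rewrite /gram -pairingD; congr pairing; apply/funext => x.
by rewrite pairing_cat.
Qed.

Lemma gram_scalel k a s t : gram k (scaleseq a s) t = a * gram k s t.
Proof. by rewrite /gram pairing_scale. Qed.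

Lemma gram_scaler k a s t : gram k s (scaleseq a t) = a * gram k s t.
Proof.
rewrite /gram -pairingZ; congr pairing; apply/funext => x.
by rewrite pairing_scale.
Qed.

Lemma gramC k s t : (forall x y, k x y = k y x) -> gram k s t = gram k t s.
Proof.
move=> kC; rewrite /gram /pairing.
under eq_bigr do rewrite mulr_sumr.
rewrite exchange_big; apply: eq_bigr => i _ /=; rewrite mulr_sumr.
by apply: eq_bigr => j _; rewrite mulrCA (kC j.2).
Qed.

Definition gramE := (gram_catl, gram_catr, gram_scalel, gram_scaler).

Lemma pairing_cvg s (u : nat -> T -> R) f :
  (forall x, (u ^~ x) @ \oo --> f x) ->
  (fun n => pairing s (u n)) @ \oo --> pairing s f.
Proof.
move=> uf; elim: s => [|i s IH].
  by under eq_fun do rewrite pairing_nil; rewrite pairing_nil; exact: cvg_cst.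
under eq_fun do rewrite -cat1s pairing_cat; rewrite -cat1s pairing_cat.
apply: cvgD IH; case: i => a x.
by under eq_fun do rewrite pairing1; rewrite pairing1; apply: cvgMr.
Qed.

End pairing.

(** * The Hilbert space of functions of finite energy *)

Section kernel_rkhs.
Context {R : realType} {T : Type} (k : T -> T -> R) (kpsd : psd_kernel k).
Implicit Types (s t : seq (R * T)) (f g : T -> R).

Let kC : forall x y, k x y = k y x := kpsd.1.
Let Q s := gram k s s.
Let Q0 s : 0 <= Q s := kpsd.2 s.

Definition energy_set f : set R := [set 2 * pairing s f - Q s | s in setT].

(* Squared RKHS norm, as a Legendre transform of the quadratic form [Q]. *)
Definition energy f : R := sup (energy_set f).

Definition kmem f := has_ubound (energy_set f).

Lemma energy_set_neq0 f : energy_set f !=set0.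
Proof. by exists (2 * pairing [::] f - Q [::]); exists [::]. Qed.

Lemma energy_ub f s : kmem f -> 2 * pairing s f - Q s <= energy f.
Proof. by move=> fm; apply: ub_le_sup => //; exists s. Qed.

Lemma energy_le f C : (forall s, 2 * pairing s f - Q s <= C) ->
  kmem f /\ energy f <= C.
Proof.
move=> h; have ub : ubound (energy_set f) C by move=> _ [s _ <-].
split; first by exists C.
by apply: ge_sup => //; exact: energy_set_neq0.
Qed.

Lemma energy_ge0 f : kmem f -> 0 <= energy f.
Proof.
move=> /(energy_ub [::]); rewrite /Q /gram !pairing_nil; lra.
Qed.

(** Testing the supremum on all multiples t s gives a quadratic in t. Together with [kmem_le], this
    identifies [energy f] as the least C >= 0 with (pairing s f)^2 <= C Q(s) for all s. *)
Lemma pairing_sqr_le f s : kmem f -> pairing s f ^+ 2 <= energy f * Q s.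
Proof.
move=> fm; apply: sqr_le_of_quadratic => // [|t]; first exact: energy_ge0.
have := energy_ub (scaleseq t s) fm; rewrite /Q pairing_scale !gramE.
by rewrite mulrA mulrA -expr2.
Qed.

(** The arithmetic-geometric inequality: 2 A <= 2 sqrt(C Q) <= C + Q whenever A^2 <= C Q. *)
Lemma kmem_le f C : 0 <= C -> (forall s, pairing s f ^+ 2 <= C * Q s) ->
  kmem f /\ energy f <= C.
Proof.
move=> C0 h; apply: energy_le => s; rewrite lerBlDr.
apply: le_trans (ler_norm _) _.
rewrite -(@ler_pXn2r _ 2) ?nnegrE ?addr_ge0//.
rewrite real_normK ?num_real// exprMn.
have := h s; have := sqr_ge0 (C - Q s).
nra.
Qed.

Lemma kmemP a f g : kmem f -> kmem g -> kmem (fun x => a * f x + g x).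
Proof.
move=> fm gm.
(* The constant comes from (u + v)^2 <= 2 u^2 + 2 v^2. *)
apply: (@kmem_le _ (2 * (a ^+ 2 * energy f + energy g)) _ _).1 => [|s].
  by rewrite mulr_ge0// addr_ge0 ?energy_ge0 // mulr_ge0 ?sqr_ge0 ?energy_ge0.
rewrite pairingP.
have := pairing_sqr_le s fm; have := pairing_sqr_le s gm.
have := sqr_ge0 (a * pairing s f - pairing s g).
have := sqr_ge0 a; set A := pairing s f; set B := pairing s g => a0 h hg hf.
have : a ^+ 2 * A ^+ 2 <= a ^+ 2 * (energy f * Q s) by rewrite ler_wpM2l.
nra.
Qed.

Lemma kmemD f g : kmem f -> kmem g -> kmem (fun x => f x + g x).
Proof.
move=> fm /(kmemP 1 fm); congr kmem; apply/funext => x.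
by rewrite mul1r.
Qed.

Lemma kmemB f g : kmem f -> kmem g -> kmem (fun x => f x - g x).
Proof.
move=> fm gm; have := kmemP (- 1) gm fm; congr kmem; apply/funext => x.
by rewrite mulN1r addrC.
Qed.

Lemma energy0 : kmem (fun=> 0) /\ energy (fun=> 0) = 0.
Proof.
have [m e] : kmem (fun=> 0) /\ energy (fun=> 0) <= 0.
  by apply: kmem_le => // s; rewrite pairing0 expr0n mul0r.
by split => //; apply/eqP; rewrite eq_le e energy_ge0.
Qed.

Lemma kmemZ a f : kmem f -> kmem (fun x => a * f x).
Proof.
move=> /(kmemP a) /(_ energy0.1); congr kmem; apply/funext => x.
by rewrite addr0.
Qed.

Lemma energyZ a f : kmem f -> energy (fun x => a * f x) = a ^+ 2 * energy f.
Proof.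
have le b g : kmem g -> energy (fun x => b * g x) <= b ^+ 2 * energy g.
  move=> gm; apply: (kmem_le _ _).2; first by rewrite mulr_ge0 ?sqr_ge0 ?energy_ge0.
  by move=> s; rewrite pairingZ exprMn -[leRHS]mulrA ler_wpM2l ?sqr_ge0
    ?pairing_sqr_le.
move=> fm; have [->|a0] := eqVneq a 0.
  rewrite expr0n mul0r -[RHS]energy0.2; congr energy.
  by apply/funext => x; rewrite mul0r.
apply/eqP; rewrite eq_le le//=.
(* The reverse inequality is the same one for a^-1 and the function a f. *)
have := le a^-1 _ (kmemZ a fm).
rewrite (_ : (fun x => a^-1 * (a * f x)) = f); last first.
  by apply/funext => x; rewrite mulKf.
by rewrite exprVn mulrC ler_pdivlMr ?exprn_even_gt0// mulrC.
Qed.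

Lemma energyN f g : kmem f -> kmem g ->
  energy (fun x => f x - g x) = energy (fun x => g x - f x).
Proof.
move=> fm gm; rewrite -[RHS]mul1r -(expr1n _ 2) -(sqrrN 1).
rewrite -energyZ; last exact: kmemB.
by congr energy; apply/funext => x; rewrite mulN1r opprB.
Qed.

(* Substituting s = u + v and t = u - v turns the two suprema on the left into
   those on the right. *)
Lemma parallelogram_le f g : kmem f -> kmem g ->
  energy (fun x => f x + g x) + energy (fun x => f x - g x)
    <= 2 * energy f + 2 * energy g.
Proof.
move=> fm gm; rewrite -lerBrDr; apply: (energy_le _).2 => s.
rewrite lerBrDr addrC -lerBrDr; apply: (energy_le _).2 => t.
rewrite lerBrDr.
have := energy_ub (scaleseq 2^-1 (s ++ t)) fm.
have := energy_ub (scaleseq 2^-1 (s ++ scaleseq (- 1) t)) gm.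
rewrite /Q !(gramE, pairing_scale, pairing_cat) pairingB pairingD (gramC t s)//.
lra.
Qed.

Lemma parallelogram f g : kmem f -> kmem g ->
  energy (fun x => f x + g x) + energy (fun x => f x - g x)
    = 2 * energy f + 2 * energy g.
Proof.
move=> fm gm; apply/eqP; rewrite eq_le parallelogram_le//=.
(* Applied to f + g and f - g, whose sum and difference are 2 f and 2 g, the inequality turns into
   its own converse. *)
have := parallelogram_le (kmemD fm gm) (kmemB fm gm).
rewrite (_ : (fun x => f x + g x + (f x - g x)) = (fun x => 2 * f x)); last first.
  by apply/funext => x; ring.
rewrite (_ : (fun x => f x + g x - (f x - g x)) = (fun x => 2 * g x)); last first.
  by apply/funext => x; ring.
rewrite !energyZ//; lra.
Qed.

(** Polarization of [energy]. Its bilinearity is the Jordan-von Neumann theorem, which rests on the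
    parallelogram law. *)
Definition kip f g : R :=
  (energy (fun x => f x + g x) - energy (fun x => f x - g x)) / 4.

Lemma kipC f g : kmem f -> kmem g -> kip f g = kip g f.
Proof.
move=> fm gm; rewrite /kip energyN//; congr ((energy _ - _) / _).
by apply/funext => x; rewrite addrC.
Qed.

Lemma kipff f : kmem f -> kip f f = energy f.
Proof.
move=> fm; rewrite /kip.
rewrite (_ : (fun x => f x + f x) = (fun x => 2 * f x)); last first.
  by apply/funext => x; ring.
rewrite (_ : (fun x => f x - f x) = (fun=> 0)); last first.
  by apply/funext => x; ring.
by rewrite energyZ// energy0.2; field.
Qed.

Lemma kipDl f g h : kmem f -> kmem g -> kmem h ->
  kip (fun x => f x + g x) h = kip f h + kip g h.
Proof.
move=> fm gm.
(* Three parallelogram laws. Between e = h and e = - h, every term that does not mix e with f or g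
   cancels, and additivity is left. *)
have step e : kmem e ->
    2 * energy (fun x => f x + g x + e x) = 2 * energy (fun x => f x + e x)
      + 2 * energy (fun x => g x + e x) + 2 * energy f + 2 * energy g
      - 2 * energy e - 2 * energy (fun x => f x - g x).
  move=> em.
  have p1 := parallelogram (kmemD fm em) gm.
  have p2 := parallelogram (kmemD gm em) fm.
  have p3 := parallelogram em (kmemB fm gm).
  rewrite (_ : (fun x => f x + e x + g x) = (fun x => f x + g x + e x)) in p1;
    last by apply/funext => x; ring.
  rewrite (_ : (fun x => g x + e x + f x) = (fun x => f x + g x + e x)) in p2;
    last by apply/funext => x; ring.
  rewrite (_ : (fun x => e x + (f x - g x)) = (fun x => f x + e x - g x)) in p3;
    last by apply/funext => x; ring.
  rewrite (_ : (fun x => e x - (f x - g x)) = (fun x => g x + e x - f x)) in p3;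
    last by apply/funext => x; ring.
  lra.
move=> hm.
have := step _ hm; have := step _ (kmemZ (- 1) hm); rewrite energyZ// /kip.
rewrite (_ : (fun x => f x + g x + -1 * h x) = (fun x => f x + g x - h x));
  last by apply/funext => x; ring.
rewrite (_ : (fun x => f x + -1 * h x) = (fun x => f x - h x));
  last by apply/funext => x; ring.
rewrite (_ : (fun x => g x + -1 * h x) = (fun x => g x - h x));
  last by apply/funext => x; ring.
lra.
Qed.

(** Additivity in the scalar is inherited from [kipDl]; the parallelogram law bounds both energies
    when |a| <= 1, and an additive function bounded near 0 is linear. *)
Lemma kipZl a f g : kmem f -> kmem g -> kip (fun x => a * f x) g = a * kip f g.
Proof.
move=> fm gm.
rewrite (@additive_bounded_linear _ (fun a => kip (fun x => a * f x) g)
  (2 * energy f + 2 * energy g)).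
- by congr (a * kip _ _); apply/funext => x; rewrite mul1r.
- move=> b c; rewrite -kipDl; try exact: kmemZ; last by [].
  by congr kip; apply/funext => x; rewrite mulrDl.
- move=> b b1; have bm := kmemZ b fm.
  have := parallelogram bm gm; have := energy_ge0 (kmemD bm gm).
  have := energy_ge0 (kmemB bm gm); rewrite energyZ// /kip.
  have : b ^+ 2 <= 1 by rewrite -real_normK ?num_real// expr_le1.
  move=> /(ler_wpM2r (energy_ge0 fm)); rewrite mul1r => h1 h2 h3 h4.
  have := energy_ge0 fm; have := energy_ge0 gm => *.
  by rewrite ler_norml; apply/andP; split; lra.
Qed.

Lemma kipP a f g h : kmem f -> kmem g -> kmem h ->
  kip (fun x => a * f x + g x) h = a * kip f h + kip g h.
Proof. by move=> fm gm hm; rewrite kipDl ?kipZl//; exact: kmemZ. Qed.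

Lemma kip_ge0 f : kmem f -> 0 <= kip f f.
Proof. by move=> fm; rewrite kipff// energy_ge0. Qed.

Lemma eval_sqr_le f x : kmem f -> f x ^+ 2 <= energy f * k x x.
Proof.
move=> /(pairing_sqr_le [:: (1, x)]).
by rewrite /Q /gram !pairing1 !mul1r.
Qed.

Lemma kernel_diag_ge0 x : 0 <= k x x.
Proof. by have := Q0 [:: (1, x)]; rewrite /Q /gram !pairing1 !mul1r. Qed.

Lemma kip_eq0 f : kmem f -> kip f f = 0 -> f = (fun=> 0).
Proof.
move=> fm; rewrite kipff// => f0; apply/funext => x.
have := eval_sqr_le x fm; rewrite f0 mul0r => h.
by apply/eqP; rewrite -sqrf_eq0 eq_le h sqr_ge0.
Qed.

Lemma keval x : exists C : R, forall f, kmem f ->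
  `|f x| <= C * Num.sqrt (kip f f).
Proof.
exists (Num.sqrt (k x x)) => f fm; rewrite kipff// mulrC -sqrtrM ?energy_ge0//.
by rewrite -sqrtr_sqr ler_wsqrtr// eval_sqr_le.
Qed.

(** Evaluations are controlled by the energy, so a Cauchy sequence converges pointwise. For a fixed
    s the bound on the squared pairing survives pointwise limits, which makes the energy lower
    semicontinuous and upgrades the convergence to the norm. The 1 added to k x x only keeps the
    divisor positive. *)
Lemma kcomplete (u : nat -> T -> R) :
  (forall n, kmem (u n)) ->
  (forall e : R, 0 < e -> exists N : nat, forall m n : nat,
     (N <= m)%N -> (N <= n)%N ->
     Num.sqrt (kip (fun x => u m x - u n x) (fun x => u m x - u n x)) < e) ->
  exists2 f, kmem f & (fun n => Num.sqrt
    (kip (fun x => u n x - f x) (fun x => u n x - f x))) @ \oo --> (0 : R).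
Proof.
move=> um uc.
have ucE e : 0 < e -> exists N : nat, forall m n : nat,
     (N <= m)%N -> (N <= n)%N -> energy (fun x => u m x - u n x) <= e ^+ 2.
  move=> e0; have [N hN] := uc e e0; exists N => m n Nm Nn.
  have mm := kmemB (um m) (um n).
  rewrite -[leLHS]sqr_sqrtr ?energy_ge0// -kipff// ler_pXn2r ?nnegrE ?sqrtr_ge0//.
    by rewrite ltW// hN.
  exact: ltW.
have pw x : cvgn (u ^~ x).
  apply: cauchy_seq_cvg => e e0.
  have e1 : 0 < e / Num.sqrt (k x x + 1).
    by rewrite divr_gt0// sqrtr_gt0 ltr_wpDl// kernel_diag_ge0.
  have [N hN] := ucE _ e1; exists N => m n Nm Nn.
  have := eval_sqr_le x (kmemB (um m) (um n)).
  have kx := kernel_diag_ge0 x.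
  have := hN m n Nm Nn; rewrite exprMn exprVn sqr_sqrtr ?addr_ge0// => h1 h2.
  have : energy (fun x0 => u m x0 - u n x0) * k x x <= e ^+ 2.
    apply: le_trans (ler_wpM2r kx h1) _.
    rewrite mulrAC ler_pdivrMr ?ltr_wpDl// ler_wpM2l ?sqr_ge0//; lra.
  move=> /(le_trans h2); rewrite -real_normK ?num_real// ler_pXn2r// nnegrE//.
  exact: ltW.
pose f x := limn (u ^~ x).
have uf x : (u ^~ x) @ \oo --> f x by exact: pw.
have close e : 0 < e -> exists N : nat, forall n : nat, (N <= n)%N ->
    kmem (fun x => u n x - f x) /\ energy (fun x => u n x - f x) <= e ^+ 2.
  move=> e0; have [N hN] := ucE e e0; exists N => n Nn.
  apply: kmem_le => [|s]; first exact: sqr_ge0.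
  have cv : (fun m => pairing s (fun x => u n x - u m x) ^+ 2) @ \oo
      --> pairing s (fun x => u n x - f x) ^+ 2.
    under eq_fun do rewrite expr2; rewrite expr2.
    by apply: cvgM; apply: pairing_cvg => x; apply: cvgB => //; exact: cvg_cst.
  apply: (cvgr_to_le cv); exists N => // m /= Nm.
  apply: le_trans (pairing_sqr_le _ (kmemB (um n) (um m))) _.
  by rewrite ler_wpM2r ?hN.
have fm : kmem f.
  have [N hN] := close 1 ltr01; have := kmemB (um N) (hN N (leqnn _)).1.
  by congr kmem; apply/funext => x; ring.
exists f => //; apply/cvgrPdist_le => e e0.
have [N hN] := close e e0; exists N => // n /= /hN[m h].
rewrite sub0r normrN ger0_norm ?sqrtr_ge0// kipff//.
by rewrite -(ler_pXn2r (n := 2)) ?nnegrE ?sqrtr_ge0 ?(ltW e0)// sqr_sqrtr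
  ?energy_ge0.
Qed.

Definition kernel_rkhs : rkhs R T :=
  Rkhs energy0.1 kmemP kipC kipP kip_ge0 kip_eq0 kcomplete keval.

(** Cauchy-Schwarz for the form [gram k], from its nonnegativity at delta_x - t s. *)
Lemma kmem_kernel x : kmem (k x).
Proof.
have kxE t : gram k [:: (1, x)] t = pairing t (k x).
  by rewrite /gram pairing1 mul1r.
apply: (@kmem_le _ (k x x) _ _).1 => [|s]; first exact: kernel_diag_ge0.
apply: sqr_le_of_quadratic => // [|t]; first exact: kernel_diag_ge0.
have := Q0 ((1, x) :: scaleseq (- t) s).
rewrite /Q -cat1s !gramE (gramC s [:: (1, x)])// !kxE pairing1 mul1r.
lra.
Qed.

(** Shifting the test families by a multiple of delta_x completes the square and gives one
    inequality; the same inequality, started from f + b k x with - b, gives the other. Polarizing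
    with b = 1 and b = -1 yields the reproducing property. *)
Lemma energy_addk f x b : kmem f ->
  energy (fun y => f y + b * k x y) = energy f + 2 * b * f x + b ^+ 2 * k x x.
Proof.
have le g c : kmem g ->
    energy (fun y => g y + c * k x y) <= energy g + 2 * c * g x + c ^+ 2 * k x x.
  move=> gm; apply: (energy_le _).2 => s.
  have := energy_ub ((- c, x) :: s) gm.
  rewrite /Q -cat1s !gramE pairing_cat pairing1 pairingD pairingZ (gramC s [::
    (- c, x)])//.
  rewrite {1 2 3}/gram !pairing1.
  lra.
move=> fm; apply/eqP; rewrite eq_le le//=.
have fbm := kmemD fm (kmemZ b (kmem_kernel x)).
have := le _ (- b) fbm.
rewrite (_ : (fun y => f y + b * k x y + - b * k x y) = f); last first.
  by apply/funext => y; ring.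
lra.
Qed.

Lemma kernel_rkhs_has_kernel : has_kernel kernel_rkhs k.
Proof.
move=> x; split=> [|f /= fm]; first exact: kmem_kernel.
rewrite /kip.
rewrite (_ : (fun y => f y + k x y) = (fun y => f y + 1 * k x y)); last first.
  by apply/funext => y; ring.
rewrite (_ : (fun y => f y - k x y) = (fun y => f y + -1 * k x y)); last first.
  by apply/funext => y; ring.
by rewrite !energy_addk//; field.
Qed.

Lemma kernel_rkhs_norm_le f C : 0 <= C ->
  (forall s, `|pairing s f| <= C * Num.sqrt (gram k s s)) ->
  rkhs_mem kernel_rkhs f /\ rkhs_norm kernel_rkhs f <= C.
Proof.
move=> C0 h; have [fm fC] : kmem f /\ energy f <= C ^+ 2.
  apply: kmem_le => [|s]; first exact: sqr_ge0.
  rewrite -real_normK ?num_real// -[Q s]sqr_sqrtr// -exprMn.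
  by rewrite ler_pXn2r ?nnegrE ?mulr_ge0 ?sqrtr_ge0// h.
split=> //; rewrite /rkhs_norm/= kipff//.
by rewrite -(ler_pXn2r (n := 2)) ?nnegrE ?sqrtr_ge0// sqr_sqrtr ?energy_ge0.
Qed.

End kernel_rkhs.

(** * Kernel combinations in an RKHS *)

Section rkhs_theory.
Context {R : realType} {T : Type} (H : rkhs R T).
Implicit Types (f g h : T -> R).
Local Notation mem := (rkhs_mem H).
Local Notation ip := (rkhs_ip H).
Local Notation nm := (rkhs_norm H).

Lemma rkhs_memD f g : mem f -> mem g -> mem (fun x => f x + g x).
Proof.
move=> fm gm; have := rkhs_memP 1 fm gm; congr (mem _); apply/funext => x.
by rewrite mul1r.
Qed.

Lemma rkhs_memZ a f : mem f -> mem (fun x => a * f x).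
Proof.
move=> fm; have := rkhs_memP a fm (rkhs_mem0 H); congr (mem _).
by apply/funext => x; rewrite addr0.
Qed.

Lemma rkhs_memB f g : mem f -> mem g -> mem (fun x => f x - g x).
Proof.
move=> fm gm; have := rkhs_memP (-1) gm fm; congr (mem _).
by apply/funext => x; rewrite mulN1r addrC.
Qed.

Lemma rkhs_ipDl f g h : mem f -> mem g -> mem h ->
  ip (fun x => f x + g x) h = ip f h + ip g h.
Proof.
move=> fm gm hm; rewrite -[ip f h]mul1r -rkhs_ipP//; congr (ip _ _).
by apply/funext => x; rewrite mul1r.
Qed.

Lemma rkhs_ip0l h : mem h -> ip (fun=> 0) h = 0.
Proof.
move=> hm; have := rkhs_ipDl (rkhs_mem0 H) (rkhs_mem0 H) hm.
rewrite (_ : (fun x => 0 + 0) = (fun=> 0)); first lra.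
by apply/funext => x; rewrite addr0.
Qed.

Lemma rkhs_ipZl a f h : mem f -> mem h -> ip (fun x => a * f x) h = a * ip f h.
Proof.
move=> fm hm; have := rkhs_ipP a fm (rkhs_mem0 H) hm.
rewrite rkhs_ip0l// addr0 => <-; congr (ip _ _).
by apply/funext => x; rewrite addr0.
Qed.

Lemma rkhs_ipBl f g h : mem f -> mem g -> mem h ->
  ip (fun x => f x - g x) h = ip f h - ip g h.
Proof.
move=> fm gm hm; rewrite addrC -mulN1r -rkhs_ipP//; congr (ip _ _).
by apply/funext => x; rewrite mulN1r addrC.
Qed.

Lemma rkhs_ipDr f g h : mem f -> mem g -> mem h ->
  ip h (fun x => f x + g x) = ip h f + ip h g.
Proof.
by move=> fm gm hm; rewrite rkhs_ipC ?rkhs_ipDl ?(rkhs_ipC hm)//; exact: rkhs_memD.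
Qed.

Lemma rkhs_ipZr a f h : mem f -> mem h -> ip h (fun x => a * f x) = a * ip h f.
Proof.
by move=> fm hm; rewrite rkhs_ipC ?rkhs_ipZl ?(rkhs_ipC hm)//; exact: rkhs_memZ.
Qed.

Lemma rkhs_ipBr f g h : mem f -> mem g -> mem h ->
  ip h (fun x => f x - g x) = ip h f - ip h g.
Proof.
by move=> fm gm hm; rewrite rkhs_ipC ?rkhs_ipBl ?(rkhs_ipC hm)//; exact: rkhs_memB.
Qed.

Lemma rkhs_norm_ge0 f : 0 <= nm f.
Proof. exact: sqrtr_ge0. Qed.

Lemma rkhs_norm_sqr f : mem f -> nm f ^+ 2 = ip f f.
Proof. by move=> fm; rewrite sqr_sqrtr// rkhs_ip_ge0. Qed.

Lemma rkhs_CauchySchwarz f g : mem f -> mem g -> `|ip f g| <= nm f * nm g.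
Proof.
move=> fm gm; have fg : mem (fun x => f x - g x) by exact: rkhs_memB.
rewrite -(ler_pXn2r (n := 2)) ?nnegrE ?mulr_ge0 ?rkhs_norm_ge0//.
rewrite real_normK ?num_real// exprMn !rkhs_norm_sqr//.
apply: sqr_le_of_quadratic => [||t]; try exact: rkhs_ip_ge0.
have tm := rkhs_memZ t gm; have := rkhs_ip_ge0 (rkhs_memB fm tm).
rewrite rkhs_ipBl ?rkhs_ipBr ?rkhs_ipZl ?rkhs_ipZr//; try exact: rkhs_memB.
rewrite (rkhs_ipC gm fm); lra.
Qed.

Lemma rkhs_normB_le f g : mem f -> mem g -> nm (fun x => f x - g x) <= nm f + nm g.
Proof.
move=> fm gm; have fg := rkhs_memB fm gm.
rewrite -(ler_pXn2r (n := 2)) ?nnegrE ?addr_ge0 ?rkhs_norm_ge0//.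
rewrite sqrrD !rkhs_norm_sqr// rkhs_ipBl ?rkhs_ipBr// (rkhs_ipC gm fm).
have := rkhs_CauchySchwarz fm gm; rewrite ler_norml => /andP[+ _].
lra.
Qed.

Lemma rkhs_normC f g : mem f -> mem g ->
  nm (fun x => f x - g x) = nm (fun x => g x - f x).
Proof.
move=> fm gm; have gf := rkhs_memB gm fm; rewrite /rkhs_norm.
rewrite (_ : (fun x => f x - g x) = (fun x => -1 * (g x - f x))); last first.
  by apply/funext => x; ring.
rewrite rkhs_ipZl ?rkhs_ipZr//; last exact: rkhs_memZ.
by rewrite !mulN1r opprK.
Qed.

Section reproducing.
Context (k : T -> T -> R) (Hk : has_kernel H k).
Implicit Types (s t : seq (R * T)).

Let km x : mem (k x). Proof. exact: (Hk x).1. Qed.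

Lemma kernel_ip x y : k x y = ip (k x) (k y).
Proof. exact: (Hk y).2. Qed.

Lemma kernel_sym x y : k x y = k y x.
Proof. by rewrite !kernel_ip rkhs_ipC. Qed.

Definition kcomb s : T -> R := fun y => pairing s (k ^~ y).

Lemma kcomb_nil : kcomb [::] = (fun=> 0).
Proof. by apply/funext => y; rewrite /kcomb pairing_nil. Qed.

Lemma kcomb_cons i s : kcomb (i :: s) = fun y => i.1 * k i.2 y + kcomb s y.
Proof. by apply/funext => y; rewrite /kcomb /pairing big_cons. Qed.

Lemma kcomb_mem s : mem (kcomb s).
Proof.
elim: s => [|i s IH]; last by rewrite kcomb_cons; exact: rkhs_memP.
by rewrite kcomb_nil; exact: rkhs_mem0.
Qed.

Lemma ip_kcomb f s : mem f -> ip f (kcomb s) = pairing s f.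
Proof.
move=> fm; elim: s => [|i s IH].
  by rewrite pairing_nil kcomb_nil rkhs_ipC ?rkhs_ip0l//; exact: rkhs_mem0.
rewrite kcomb_cons rkhs_ipDr//; first 1 last.
- exact: rkhs_memZ.
- exact: kcomb_mem.
by rewrite IH rkhs_ipZr// /pairing big_cons (Hk _).2.
Qed.

Lemma ip_kcomb2 s t : ip (kcomb s) (kcomb t) = gram k s t.
Proof.
rewrite ip_kcomb; last exact: kcomb_mem.
rewrite [RHS]gramC; last exact: kernel_sym.
rewrite /gram; congr pairing; apply/funext => x; congr pairing.
by apply/funext => y; exact: kernel_sym.
Qed.

(* A sequence of kernel combinations minimizing the distance to [f] is Cauchy,
   and near-minimality against adding a multiple of [k x] forces its pointwise
   limit to be [f]. *)
Lemma kcomb_dense f e : mem f -> 0 < e ->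
  exists s, nm (fun x => f x - kcomb s x) <= e.
Proof.
move=> fm e0.
pose J s := ip (fun x => f x - kcomb s x) (fun x => f x - kcomb s x).
have mB s : mem (fun x => f x - kcomb s x) by apply: rkhs_memB => //;
  exact: kcomb_mem.
have JE s : J s = ip f f - 2 * pairing s f + gram k s s.
  have cm := kcomb_mem s; have fcm := mB s.
  rewrite /J rkhs_ipBl ?rkhs_ipBr// (rkhs_ipC cm fm) ip_kcomb// ip_kcomb2.
  ring.
have J0 s : 0 <= J s by exact: rkhs_ip_ge0.
have hinf : has_inf (range J).
  by split; [exists (J [::]); exists [::]|exists 0 => _ [s _ <-]].
pose D := inf (range J).
have DJ s : D <= J s by apply: ge_inf; [exact: hinf.2|exists s].
have uex (n : nat) : exists s, J s <= D + n.+1%:R^-1.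
  have n0 : 0 < n.+1%:R^-1 :> R by rewrite invr_gt0 ltr0n.
  have [_ [s _ <-] h] := inf_adherent n0 hinf.
  by exists s; exact: ltW.
have [u uJ] := choice uex.
(* The midpoint argument of the projection theorem: the squared distance equals 2 J(s) + 2 J(t) - 4
   J((s + t) / 2), and J >= D at the midpoint. *)
have kB s t : nm (fun x =>
  kcomb s x - kcomb t x) ^+ 2 <= 2 * (J s - D) + 2 * (J t - D).
  have sm := kcomb_mem s; have tm := kcomb_mem t.
  have stm := rkhs_memB sm tm.
  rewrite rkhs_norm_sqr// rkhs_ipBl ?rkhs_ipBr// !ip_kcomb2.
  have := DJ (scaleseq 2^-1 (s ++ t)).
  rewrite !JE !(gramE, pairing_scale, pairing_cat) (gramC t s);
    last exact: kernel_sym.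
  lra.
have inv_small a : 0 < a -> exists N :
  nat, forall n, (N <= n)%N -> n.+1%:R^-1 <= a :> R.
  move=> a0; have /cvgrPdist_le/(_ _ a0)[N _ hN] := @cvg_harmonic R.
  by exists N => n /hN; rewrite sub0r normrN ger0_norm// harmonic_ge0.
(* Adding a delta_x to u_n changes J by - 2 a (f x - kcomb (u n) x) + a^2 k x x, which cannot fall
   below D - J(u_n) for any a. *)
have near_min x n : (f x - kcomb (u n) x) ^+ 2 <= n.+1%:R^-1 * k x x.
  apply: (@le_trans _ _ ((J (u n) - D) * k x x)); last first.
    apply: ler_wpM2r; last by rewrite lerBlDl.
    by rewrite kernel_ip rkhs_ip_ge0.
  apply: sqr_le_of_quadratic => [||a].
  - by rewrite kernel_ip rkhs_ip_ge0.
  - by rewrite subr_ge0.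
  have := DJ ((a, x) :: u n).
  rewrite !JE -cat1s !gramE pairing_cat (gramC (u n) [:: (a, x)]);
    last exact: kernel_sym.
  have -> : gram k [:: (a, x)] (u n) = a * kcomb (u n) x.
    rewrite /gram pairing1 /kcomb; congr (a * pairing _ _).
    by apply/funext => y; rewrite kernel_sym.
  by rewrite /gram !pairing1; lra.
have [g gm ug] : exists2 g, mem g & (fun n => nm (fun x =>
  kcomb (u n) x - g x)) @ \oo --> (0 : R).
  apply: rkhs_complete => [n|a a0]; first exact: kcomb_mem.
  (* With excess at most a^2 / 8 on both sides, [kB] bounds the squared distance by a^2 / 2,
     strictly below a^2. *)
  have [|N hN] := inv_small (a ^+ 2 / 8); first by rewrite divr_gt0// exprn_gt0.
  have JN n : (N <= n)%N -> J (u n) <= D + a ^+ 2 / 8.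
    by move=> /hN h; apply: le_trans (uJ n) _; rewrite lerD2l.
  exists N => m n /JN hm /JN hn.
  rewrite -(ltr_pXn2r (n := 2)) ?nnegrE ?rkhs_norm_ge0 ?(ltW a0)//.
  apply: le_lt_trans (kB _ _) _.
  have : 0 < a ^+ 2 by rewrite exprn_gt0.
  lra.
have fg : f = g.
  apply/funext => x.
  have cf : (fun n => kcomb (u n) x) @ \oo --> f x.
    apply/cvgrPdist_le => a a0.
    have kx : 0 <= k x x by rewrite kernel_ip rkhs_ip_ge0.
    have [|N hN] := inv_small (a ^+ 2 / (k x x + 1)).
      by rewrite divr_gt0 ?exprn_gt0// ltr_wpDl.
    exists N => // n /= /hN h.
    rewrite -(ler_pXn2r (n := 2)) ?nnegrE ?(ltW a0)// real_normK ?num_real//.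
    apply: le_trans (near_min _ _) _; apply: le_trans (ler_wpM2r kx h) _.
    rewrite mulrAC ler_pdivrMr ?ltr_wpDl// ler_wpM2l ?sqr_ge0//; lra.
  have cg : (fun n => kcomb (u n) x) @ \oo --> g x.
    have [C hC] := rkhs_eval H x.
    apply/cvgrPdist_le => a a0.
    have C1 : 0 < `|C| + 1 by rewrite ltr_wpDl.
    move/cvgrPdist_le : ug => /(_ (a / (`|C| + 1))); rewrite divr_gt0// => /(_ isT).
    apply: filterS => n; rewrite sub0r normrN ger0_norm ?rkhs_norm_ge0// => h.
    have := hC _ (rkhs_memB (kcomb_mem (u n)) gm); rewrite distrC => /le_trans;
      apply.
    apply: (@le_trans _ _ ((`|C| + 1) * (a / (`|C| + 1)))).
      have CC : C <= `|C| + 1 by rewrite (le_trans (ler_norm _))// lerDl.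
      apply: le_trans (ler_wpM2r (rkhs_norm_ge0 _) CC) _.
      by rewrite ler_wpM2l// ltW.
    by rewrite mulrC divfK// gt_eqF.
  by rewrite -(cvg_lim (@norm_hausdorff _ _) cf) -(cvg_lim (@norm_hausdorff _
    _) cg).
move/cvgrPdist_le : ug => /(_ _ e0)[N _ /(_ _ (leqnn _))].
rewrite sub0r normrN ger0_norm ?rkhs_norm_ge0// -fg rkhs_normC//;
  last exact: kcomb_mem.
by exists (u N).
Qed.

End reproducing.
End rkhs_theory.

(** * Measures with a density, laws and mixtures *)

Definition prob_density d (T : measurableType d) (R : realType)
    (mu : {measure set T -> \bar R}) (w : T -> R) : Prop :=
  [/\ measurable_fun setT w, forall x, 0 <= w x & (\int[mu]_x (w x)%:E = 1)%E].

(* The proof argument only serves to attach the probability structure. *)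
Definition density_measure d (T : measurableType d) (R : realType)
    (mu : {measure set T -> \bar R}) (w : T -> R) (_ : prob_density mu w) :
    set T -> \bar R :=
  fun A => (\int[mu]_(x in A) (w x)%:E)%E.

Section density_measure.
Local Open Scope ereal_scope.
Context d (T : measurableType d) (R : realType).
Context (mu : {measure set T -> \bar R}) (w : T -> R) (hw : prob_density mu w).

Let mw : measurable_fun setT (fun x => (w x)%:E).
Proof. by apply/measurable_EFinP; case: hw. Qed.

Let w0 x : 0 <= (w x)%:E.
Proof. by rewrite lee_fin; case: hw. Qed.

Local Notation nu := (density_measure hw).

Let nu0 : nu set0 = 0.
Proof. by rewrite /density_measure integral_set0. Qed.

Let nu_ge0 A : 0 <= nu A.
Proof. exact: integral_ge0. Qed.

Let nu_additive : semi_sigma_additive nu.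
Proof.
move=> A mA tA mUA; rewrite /density_measure ge0_integral_bigcup//; last first.
  exact: measurable_funTS.
by apply: is_cvg_ereal_nneg_natsum_cond => n _ _; exact: integral_ge0.
Qed.

HB.instance Definition _ := isMeasure.Build _ _ _ nu nu0 nu_ge0 nu_additive.

Let nu_setT : nu setT = 1.
Proof. by case: hw. Qed.

HB.instance Definition _ := Measure_isProbability.Build _ _ _ nu nu_setT.

Import HBNNSimple.

(** True for indicators by the definition of the measure, then for simple functions by linearity,
    and in general by monotone convergence on both sides. *)
Lemma ge0_integral_density (f : T -> \bar R) : (forall x, 0 <= f x) ->
  measurable_fun setT f -> \int[nu]_x f x = \int[mu]_x (f x * (w x)%:E).
Proof.
move=> f0 mf; pose h := nnsfun_approx measurableT mf.
have hf x : (EFin \o h n) x @[n --> \oo] --> f x.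
  by apply: cvg_nnsfun_approx.
transitivity (lim (\int[nu]_x (EFin \o h n) x @[n --> \oo])).
  rewrite -monotone_convergence//.
  - by apply: eq_integral => x _; apply/esym/cvg_lim => //; exact: hf.
  - by move=> n; exact/measurable_EFinP.
  - by move=> n x _ /=; rewrite lee_fin.
  - by move=> x _ a b ab; rewrite lee_fin; exact/lefP/nd_nnsfun_approx.
transitivity (lim (\int[mu]_x ((EFin \o h n) x * (w x)%:E) @[n --> \oo]));
  last first.
  rewrite -monotone_convergence//.
  - apply: eq_integral => x _; apply/cvg_lim => //.
    by apply: cvgeZr => //; exact: hf.
  - by move=> n; apply: emeasurable_funM => //; exact/measurable_EFinP.
  - by move=> n x _; apply: mule_ge0 => //=; rewrite lee_fin.
  - move=> x _ a b ab/=; rewrite lee_wpmul2r// lee_fin.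
    exact/lefP/nd_nnsfun_approx.
apply: congr_lim; apply/funext => n.
transitivity (\int[nu]_x
   (\sum_(y \in range (h n)) (y * \1_(h n @^-1` [set y]) x)%:E)).
  by apply: eq_integral => t _; rewrite /= fimfunE -fsumEFin.
have mi r : measurable_fun setT (fun x => (r * \1_(h n @^-1` [set r]) x)%:E).
  by apply/measurable_EFinP; exact: measurable_funM.
rewrite ge0_integral_fsum//; last by move=> y x _; exact: nnfun_muleindic_ge0.
transitivity (\int[mu]_x (\sum_(y \in range (h n))
    (y * \1_(h n @^-1` [set y]) x)%:E * (w x)%:E)); last first.
  apply: eq_integral => x _.
  rewrite -ge0_mule_fsuml => [|y]; last exact: nnfun_muleindic_ge0.
  by rewrite fsumEFin// -(fimfunE _ x).
rewrite ge0_integral_fsum//; last 2 first.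
  - by move=> y; apply: emeasurable_funM.
  - by move=> y x _; rewrite mule_ge0// nnfun_muleindic_ge0.
apply: eq_fsbigr => r rhn.
under eq_integral do rewrite EFinM.
rewrite integralZl_indic_nnsfun => //.
under [RHS]eq_integral do rewrite EFinM -muleA.
rewrite ge0_integralZl//.
- congr (_ * _); rewrite integral_indic// setIT /density_measure.
  rewrite [LHS]integral_mkcond; apply: eq_integral => x _.
  by rewrite epatch_indic muleC.
- by apply: emeasurable_funM => //; exact/measurable_EFinP.
- by move=> t _; apply: mule_ge0 => //; rewrite lee_fin indicE ler0n.
- by move: rhn; rewrite inE => -[t _ <-]; rewrite lee_fin.
Qed.

Let funepos_densityM (f : T -> \bar R) :
  (fun x => f^\+ x * (w x)%:E) = (fun x => f x * (w x)%:E)^\+.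
Proof.
apply/funext => x; rewrite !funeposE.
by rewrite maxe_pMl// mul0e.
Qed.

Let funeneg_densityM (f : T -> \bar R) :
  (fun x => f^\- x * (w x)%:E) = (fun x => f x * (w x)%:E)^\-.
Proof.
apply/funext => x; rewrite !funenegE.
by rewrite maxe_pMl// mul0e mulNe.
Qed.

(** Since w >= 0, the positive and negative parts of f w are those of f times w; hence the identity
    requires no integrability. *)
Lemma integral_density (f : T -> \bar R) : measurable_fun setT f ->
  \int[nu]_x f x = \int[mu]_x (f x * (w x)%:E).
Proof.
move=> mf; rewrite [LHS]integralE [RHS]integralE !ge0_integral_density//.
- by rewrite funepos_densityM funeneg_densityM.
- exact: measurable_funeneg.
- exact: measurable_funepos.
Qed.

End density_measure.

Section laws.
Local Open Scope ereal_scope.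
Context d d' (T : measurableType d) (T' : measurableType d') (R : realType).

Lemma integral_pushforward_total (mu : {measure set T -> \bar R}) (phi : T -> T')
    (f : T' -> \bar R) (mphi : measurable_fun setT phi) : measurable_fun setT f ->
  \int[pushforward mu phi]_y f y = \int[mu]_x f (phi x).
Proof.
move=> mf; rewrite [LHS]integralE [RHS]integralE; congr (_ - _).
  rewrite (ge0_integral_pushforward mphi)//; last exact: measurable_funepos.
  by rewrite preimage_setT; apply: eq_integral => x _; rewrite /= !funeposE.
rewrite (ge0_integral_pushforward mphi)//; last exact: measurable_funeneg.
by rewrite preimage_setT; apply: eq_integral => x _; rewrite /= !funenegE.
Qed.

Lemma exists_law (P : probability T R) (phi : T -> T') : measurable_fun setT phi ->
  exists Q : probability T' R, forall f : T' -> \bar R, measurable_fun setT f ->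
    \int[Q]_y f y = \int[P]_x f (phi x).
Proof.
move=> mphi; exists (distribution P (mfun_Sub (mem_set mphi))) => f mf.
exact: integral_pushforward_total.
Qed.

Lemma exists_density_law (mu : {measure set T -> \bar R}) (w : T -> R)
    (phi : T -> T') : prob_density mu w -> measurable_fun setT phi ->
  exists Q : probability T' R, forall f : T' -> \bar R, measurable_fun setT f ->
    \int[Q]_y f y = \int[mu]_x (f (phi x) * (w x)%:E).
Proof.
move=> hw mphi; have [Q hQ] := exists_law (density_measure hw) mphi.
by exists Q => f mf; rewrite hQ// integral_density//;
  exact: (measurableT_comp mf mphi).
Qed.

End laws.

Section mixture.
Local Open Scope ereal_scope.
Context d (T : measurableType d) (R : realType) (P : nat -> probability T R).

Let c_ge0 (n : nat) : (0 <= (2^-1) ^+ n.+1 :> R)%R.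
Proof. by rewrite exprn_ge0// invr_ge0. Qed.

Let c (n : nat) : {nonneg R} := NngNum (c_ge0 n).

Definition geometric_mixture : set T -> \bar R :=
  mseries (fun n => mscale (c n) (P n)) 0.

HB.instance Definition _ := Measure.on geometric_mixture.

Let mixture_setT : geometric_mixture setT = 1.
Proof.
have := @cvg_geometric_eseries_half R 1 0; rewrite expr0 divr1 => /cvg_lim <- //.
congr (limn _); apply/funext => n; apply: eq_bigr => k _.
transitivity (((2^-1) ^+ k.+1)%:E * P k setT) => //.
by rewrite probability_setT mule1 addn1 natrX div1r exprVn.
Qed.

HB.instance Definition _ :=
  Measure_isProbability.Build _ _ _ geometric_mixture mixture_setT.

Lemma ge0_integral_mixture (f : T -> \bar R) : measurable_fun setT f ->
  (forall x, 0 <= f x) ->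
  \int[geometric_mixture]_x f x =
    \sum_(n <oo) ((2^-1) ^+ n.+1)%:E * \int[P n]_x f x.
Proof.
move=> mf f0; rewrite ge0_integral_measure_series//.
by apply: eq_eseriesr => n _; rewrite ge0_integral_mscale.
Qed.

(** Exchange of sum and integral for signed functions: the finite sum of absolute integrals
    dominates the series of both the positive and the negative parts. *)
Lemma integral_mixture (f : T -> R) : measurable_fun setT f ->
  \sum_(n <oo) ((2^-1) ^+ n.+1)%:E * \int[P n]_x `|(f x)%:E| < +oo ->
  geometric_mixture.-integrable setT (fun x => (f x)%:E) /\
  \int[geometric_mixture]_x (f x)%:E =
    \sum_(n <oo) ((2^-1) ^+ n.+1)%:E * \int[P n]_x (f x)%:E.
Proof.
move=> mf foo; have mEf : measurable_fun setT (fun x => (f x)%:E).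
  exact/measurable_EFinP.
have fi : geometric_mixture.-integrable setT (fun x => (f x)%:E).
  by apply/integrableP; split => //; rewrite ge0_integral_mixture//;
    exact: measurableT_comp.
split=> //.
have mabs : measurable_fun setT (fun x => `|(f x)%:E|) by exact: measurableT_comp.
have mpos : measurable_fun setT (fun x => (f x)%:E)^\+ by exact: measurable_funepos.
have mneg : measurable_fun setT (fun x => (f x)%:E)^\- by exact: measurable_funeneg.
have c_gt0 n : (0 < (2^-1) ^+ n.+1 :> R)%R by rewrite exprn_gt0// invr_gt0.
have If0 n : 0 <= ((2^-1) ^+ n.+1)%:E * \int[P n]_x `|(f x)%:E|.
  by rewrite mule_ge0 ?lee_fin// integral_ge0.
have Pfi n : (P n).-integrable setT (fun x => (f x)%:E).
  apply/integrableP; split => //; rewrite -(@lte_pmul2l _ ((2^-1) ^+ n.+1)%:E)//.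
  rewrite gt0_muley ?lte_fin//; apply: le_lt_trans foo.
  by rewrite (@nneseriesD1 _ _ n)// leeDl// nneseries_ge0.
have int_c n : \int[mscale (c n) (P n)]_x (f x)%:E =
    ((2^-1) ^+ n.+1)%:E * \int[P n]_x (f x)%:E.
  rewrite [LHS]integralE !ge0_integral_mscale// -muleBr//.
    by rewrite -integralE.
  rewrite fin_num_adde_defl// fin_numN.
  exact: (integrable_neg_fin_num measurableT (Pfi n)).
have ci n : (mscale (c n) (P n)).-integrable setT (fun x => (f x)%:E).
  apply/integrableP; split => //; rewrite ge0_integral_mscale//.
  by rewrite lte_mul_pinfty ?lee_fin//; have /integrableP[] := Pfi n.
have bnd (g : T -> \bar R) : measurable_fun setT g -> (forall x, 0 <= g x) ->
    (forall x, g x <= `|(f x)%:E|) ->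
    \sum_(n <oo) `|\int[mscale (c n) (P n)]_x g x| < +oo.
  move=> mg g0 gf; apply: le_lt_trans foo; apply: lee_nneseries => // n _.
  rewrite gee0_abs ?integral_ge0// ge0_integral_mscale//.
  by rewrite lee_wpmul2l ?lee_fin// ge0_le_integral.
rewrite integral_measure_series//; last 2 first.
- apply: bnd => // x.
  by rewrite funenegE /= ge_max !lee_fin ler_normr lexx orbT normr_ge0.
- apply: bnd => // x.
  by rewrite funeposE /= ge_max !lee_fin ler_norm normr_ge0.
by apply: eq_eseriesr => n _; exact: int_c.
Qed.

End mixture.

(** * Euclidean geometry and linear functions on [X] *)

Section euclidean.
Context {R : realType} {d : nat}.
Implicit Types (x y z w : 'rV[R]_d).

Lemma dotC z w : dot z w = dot w z.
Proof. by apply: eq_bigr => i _; rewrite mulrC. Qed.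

Lemma dotDl z w x : dot (z + w) x = dot z x + dot w x.
Proof. by rewrite /dot -big_split; apply: eq_bigr => i _; rewrite mxE mulrDl. Qed.

Lemma dotZl a z x : dot (a *: z) x = a * dot z x.
Proof. by rewrite /dot mulr_sumr; apply: eq_bigr => i _; rewrite mxE mulrA. Qed.

Lemma dotBl z w x : dot (z - w) x = dot z x - dot w x.
Proof. by rewrite dotDl -scaleN1r dotZl mulN1r. Qed.

Lemma dotDr z w x : dot x (z + w) = dot x z + dot x w.
Proof. by rewrite !(dotC x) dotDl. Qed.

Lemma dotZr a z x : dot x (a *: z) = a * dot x z.
Proof. by rewrite !(dotC x) dotZl. Qed.

Lemma dotBr z w x : dot x (z - w) = dot x z - dot x w.
Proof. by rewrite !(dotC x) dotBl. Qed.

Lemma dot_ge0 z : 0 <= dot z z.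
Proof. by apply: sumr_ge0 => i _; rewrite -expr2 sqr_ge0. Qed.

Lemma enorm_ge0 z : 0 <= enorm z.
Proof. exact: sqrtr_ge0. Qed.

Lemma enorm_sqr z : enorm z ^+ 2 = dot z z.
Proof. by rewrite sqr_sqrtr// dot_ge0. Qed.

Lemma dot_CauchySchwarz z x : `|dot z x| <= enorm z * enorm x.
Proof.
rewrite -(ler_pXn2r (n := 2)) ?nnegrE ?mulr_ge0 ?enorm_ge0//.
rewrite real_normK ?num_real// exprMn !enorm_sqr.
apply: sqr_le_of_quadratic => [||t]; try exact: dot_ge0.
have := dot_ge0 (z - t *: x); rewrite dotBl !dotBr !dotZl !dotZr (dotC x z).
lra.
Qed.

Lemma enormZ a z : enorm (a *: z) = `|a| * enorm z.
Proof.
rewrite /enorm dotZl dotZr mulrA -expr2 sqrtrM ?sqr_ge0//.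
by rewrite sqrtr_sqr.
Qed.

Lemma enormN z : enorm (- z) = enorm z.
Proof. by rewrite -scaleN1r enormZ normrN1 mul1r. Qed.

Lemma coord_le_enorm z i : `|z ord0 i| <= enorm z.
Proof.
rewrite /enorm -sqrtr_sqr ler_wsqrtr// /dot (bigD1 i)//= -expr2 lerDl.
by apply: sumr_ge0 => j _; rewrite -expr2 sqr_ge0.
Qed.

Lemma norm_le_enorm z : `|z| <= enorm z.
Proof.
have [->|z0] := eqVneq z 0; first by rewrite normr0 enorm_ge0.
have : mx_norm z != 0 by apply: contra z0 => /eqP/mx_norm_eq0 ->.
rewrite /Num.norm /= => /mx_norm_neq0[[i j] ->/=].
by rewrite (ord1 i) coord_le_enorm.
Qed.

Lemma enorm0 : enorm (0 : 'rV[R]_d) = 0.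
Proof. by rewrite -[0](scale0r 0) enormZ normr0 mul0r. Qed.

Lemma enorm_eq0 z : (enorm z == 0) = (z == 0).
Proof.
apply/eqP/eqP => [z0|->]; last exact: enorm0.
by apply/eqP; rewrite -normr_le0 -z0 norm_le_enorm.
Qed.

Lemma dot_continuous x : continuous (fun z : 'rV[R]_d => dot z x).
Proof.
apply: continuous_big => [|i _]; first exact: add_continuous.
by move=> z; apply: continuousM; [exact: coord_continuous|exact: cst_continuous].
Qed.

Lemma enorm_continuous : continuous (@enorm R d).
Proof.
move=> z; apply: continuous_comp; last exact: sqrt_continuous.
apply: continuous_big => [|i _]; first exact: add_continuous.
by move=> w; apply: continuousM; exact: coord_continuous.
Qed.

(** With its converse [enorm_ball_open], this identifies the sup-norm topology with the Euclidean
    one, in the form matching [H1_open]. *)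
Lemma open_enorm_ball (U : set 'rV[R]_d) z : open U -> U z ->
  exists2 e : R, 0 < e & forall w, enorm (w - z) < e -> U w.
Proof.
move=> oU Uz; have /nbhs_ballP[e e0 h] := open_nbhs_nbhs (conj oU Uz).
exists e => // w wz; apply: h; rewrite -ball_normE/=.
by rewrite distrC (le_lt_trans (norm_le_enorm _)).
Qed.

Lemma enorm_ball_open (U : set 'rV[R]_d) :
  (forall z, U z -> exists2 e : R, 0 < e & forall w, enorm (w - z) < e -> U w) ->
  open U.
Proof.
move=> h; rewrite openE => z /h[e e0 he].
have cz : (fun w => enorm (w - z)) @ z --> enorm (z - z).
  apply: (@continuous_comp _ _ _ (fun w => w - z) (@enorm R d)).
    by apply: continuousB; [exact: cvg_id|exact: cst_continuous].
  exact: enorm_continuous.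
rewrite subrr enorm0 in cz.
exact: (@filterS _ _ (nbhs_filter z) _ _ he (cvgr_lt _ cz e e0)).
Qed.

Lemma open_neq0 : open (~` [set 0 : 'rV[R]_d]).
Proof.
apply: enorm_ball_open => z /eqP z0; exists (enorm z).
  by rewrite lt0r enorm_ge0 enorm_eq0 z0.
by move=> w + w0; rewrite w0 sub0r enormN ltxx.
Qed.

(** As the inverse of 0 is 0, the zero vector is sent to 0: the norm is only bounded by 1, but
    [normalizeK] holds without exception. *)
Definition normalize z : 'rV[R]_d := (enorm z)^-1 *: z.

Lemma enorm_normalize z : enorm (normalize z) <= 1.
Proof.
rewrite enormZ normfV ger0_norm ?enorm_ge0//.
by have [->|z0] := eqVneq (enorm z) 0; rewrite ?mulr0 ?mulVf.
Qed.

Lemma normalizeK z : enorm z *: normalize z = z.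
Proof.
have [z0|z0] := eqVneq (enorm z) 0; last by rewrite scalerA mulfV ?scale1r.
by rewrite z0 scale0r; apply/esym/eqP; rewrite -enorm_eq0 z0.
Qed.

Lemma measurable_continuous (f : borelRd R d -> R) :
  continuous (f : 'rV[R]_d -> R) -> measurable_fun setT f.
Proof.
move=> cf; apply: (measurability _ (RGenOpens.measurableE R)).
move=> _ [_ [a [b ->] <-]]; rewrite setTI; apply: sub_sigma_algebra.
by apply: open_comp; [move=> *; exact: cf|exact: interval_open].
Qed.

(** The map is continuous away from 0, so the preimage of an open set is an open set together with a
    subset of {0}. *)
Lemma measurable_normalize :
  measurable_fun setT (normalize : borelRd R d -> borelRd R d).
Proof.
apply: (@measurability _ _ (borelRd R d) (borelRd R d) setT normalize
  (@open 'rV[R]_d) erefl).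
move=> _ [U oU <-]; rewrite setTI.
have -> : normalize @^-1` U =
    ((normalize @^-1` U) `&` ~` [set 0]) `|` ((normalize @^-1` U) `&` [set 0]).
  by rewrite -setIUr setUC setUv setIT.
apply: (@measurableU _ (borelRd R d)).
  apply: sub_sigma_algebra; rewrite openE => z [Uz z0].
  have cn : normalize @ z --> normalize z.
    apply: (@continuousZ _ _ _ (fun w : 'rV[R]_d => (enorm w)^-1) id z);
      last exact: cvg_id.
    apply: continuousV; last exact: enorm_continuous.
    by rewrite enorm_eq0; apply/eqP.
  apply: filterI; first by apply: cn; apply: open_nbhs_nbhs.
  apply: open_nbhs_nbhs; split => //; exact: open_neq0.
have m0 : (@measurable _ (borelRd R d)) [set 0].
  rewrite -[[set 0]]setCK; apply: measurableC; apply: sub_sigma_algebra.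
  exact: open_neq0.
have [U0|U0] := pselect (U 0).
  rewrite (_ : _ `&` _ = [set 0])//; apply/seteqP; split=> [z [_ ->]//|z /= ->].
  by split => //; rewrite /preimage/= /normalize scaler0.
rewrite (_ : _ `&` _ = set0) ?measurable0//; apply/seteqP; split=> // z [/= + z0].
by rewrite z0 /normalize scaler0.
Qed.

End euclidean.

(** * Minimal Euclidean representatives of linear functions on X *)

Section H1_geometry.
Context {R : realType} {d : nat} (X : set 'rV[R]_d).
Implicit Types (z w : 'rV[R]_d).

Definition linfun_of z : X -> R := fun x => dot z (val x).

Definition null_on w := forall x : X, dot w (val x) = 0.

(** Minimality is stated as orthogonality to all vectors that vanish on X; this condition is linear
    in z, and by Pythagoras it implies minimality of the norm. *)
Definition minimal_rep z := forall w, null_on w -> dot z w = 0.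

Lemma linfun_of_inj_null z w : linfun_of z = linfun_of w -> null_on (z - w).
Proof.
move=> zw x; rewrite dotBl; apply/eqP; rewrite subr_eq0; apply/eqP.
exact: (congr1 (fun g : X -> R => g x) zw).
Qed.

Lemma linfun_norm_le z : linfun_norm (linfun_of z) <= enorm z.
Proof.
apply: ge_inf; last by exists z.
by exists 0 => _ [w _ <-]; exact: enorm_ge0.
Qed.

Lemma linfun_norm_minimal z : minimal_rep z -> linfun_norm (linfun_of z) = enorm z.
Proof.
move=> mz; apply/eqP; rewrite eq_le linfun_norm_le/=.
apply: lb_le_inf; first by exists (enorm z); exists z.
move=> _ [w /= zw <-].
rewrite -(ler_pXn2r (n := 2)) ?nnegrE ?enorm_ge0// !enorm_sqr.
have wz := linfun_of_inj_null (esym zw); have := mz _ wz; rewrite dotBr.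
have := dot_ge0 (w - z); rewrite dotBl !dotBr (dotC w z).
lra.
Qed.

Lemma closed_linfun_of (h : X -> R) : closed [set z | h = linfun_of z].
Proof.
rewrite (_ : [set z | _] = \bigcap_(x in [set: X]) [set z | dot z (val x) = h x]).
  apply: closed_bigI => x _.
  rewrite (_ : [set z | _] = (fun z => dot z (val x)) @^-1` [set h x])//.
  apply: closed_comp; first by move=> *; exact: dot_continuous.
  exact: closed_eq.
apply/seteqP; split=> z /= => [-> x //|zh].
by apply/funext => x; rewrite -zh.
Qed.

(** Compactness gives a representative of least norm. Moving it along a null vector w does not
    change h, so the first variation in direction w vanishes. *)
Lemma exists_minimal_rep (h : X -> R) : linfuns h ->
  exists2 z, h = linfun_of z & minimal_rep z.
Proof.
case=> z0 hz0.
pose A := [set z | h = linfun_of z] `&` [set z | enorm z <= enorm z0].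
have cA : compact A.
  apply: bounded_closed_compact.
    exists (enorm z0); split; first exact: num_real.
    move=> M /ltW zM z [_ /= zz0].
    by rewrite (le_trans (norm_le_enorm _))// (le_trans zz0).
  apply: closedI; first exact: closed_linfun_of.
  apply: (@closed_comp _ _ (@enorm R d) [set r | r <= enorm z0]).
    by move=> *; exact: enorm_continuous.
  exact: closed_le.
have A0 : A !=set0 by exists z0; split => /=.
have [z /[!inE] -[/= hz zz0] zmin] := EVT_min_rV A0 cA
  (continuous_subspaceT (@enorm_continuous R d)).
exists z => // w w0.
have le t : dot z z <= dot (z - t *: w) (z - t *: w).
  rewrite -!enorm_sqr ler_pXn2r ?nnegrE ?enorm_ge0//.
  (* A competitor outside the ball is longer than z, which lies inside. *)
  have [|/ltW] := leP (enorm (z - t *: w)) (enorm z0); last exact: le_trans.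
  move=> h1; apply: zmin; rewrite inE; split => //=.
  by rewrite hz; apply/funext => x; rewrite /linfun_of dotBl dotZl w0 mulr0 subr0.
have : dot z w ^+ 2 <= 0 * dot w w.
  apply: sqr_le_of_quadratic => // [|t]; first exact: dot_ge0.
  by have := le t; rewrite dotBl !dotBr !dotZl !dotZr (dotC w z); lra.
rewrite mul0r => h1; by apply/eqP; rewrite -sqrf_eq0 eq_le h1 sqr_ge0.
Qed.

Definition min_rep (h : H1 X) : 'rV[R]_d :=
  sval (cid2 (exists_minimal_rep (set_mem (valP h)))).

Lemma min_repE h : val h = linfun_of (min_rep h).
Proof. by rewrite /min_rep; case: cid2. Qed.

Lemma min_rep_minimal h : minimal_rep (min_rep h).
Proof. by rewrite /min_rep; case: cid2. Qed.

Lemma H1_normE h : H1_norm h = enorm (min_rep h).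
Proof. by rewrite /H1_norm min_repE linfun_norm_minimal//;
  exact: min_rep_minimal. Qed.

(** A difference of minimal representatives is again minimal. So [min_rep] is an isometry, which is
    what makes it Borel measurable. *)
Lemma min_rep_isometry g h :
  linfun_norm (fun x : X => val g x - val h x) = enorm (min_rep g - min_rep h).
Proof.
rewrite !min_repE -linfun_norm_minimal; last first.
  by move=> w w0; rewrite dotBl !min_rep_minimal// subr0.
by congr linfun_norm; apply/funext => x; rewrite /linfun_of dotBl.
Qed.

Lemma measurable_min_rep : measurable_fun setT (min_rep : borelH1 X -> borelRd R d).
Proof.
apply: (@measurability _ _ (borelH1 X) (borelRd R d) setT min_rep
  (@open 'rV[R]_d) erefl).
move=> _ [U oU <-]; rewrite setTI; apply: sub_sigma_algebra => h Uh.
have [e e0 he] := open_enorm_ball oU Uh; exists e => // g gh.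
by apply: he; rewrite -min_rep_isometry.
Qed.

Lemma linfun_ofP z : linfun_of z \in @linfuns R d X.
Proof. by apply/mem_set; exists z. Qed.

Definition toH1 z : H1 X := exist _ (linfun_of z) (linfun_ofP z).

Lemma H1_norm_toH1 z : H1_norm (toH1 z) <= enorm z.
Proof. exact: linfun_norm_le. Qed.

Lemma measurable_toH1 : measurable_fun setT (toH1 : borelRd R d -> borelH1 X).
Proof.
apply: (@measurability _ _ (borelRd R d) (borelH1 X) setT toH1
  (@H1_open R d X) erefl).
move=> _ [U oU <-]; rewrite setTI; apply: sub_sigma_algebra.
apply: enorm_ball_open => z /oU[e e0 he]; exists e => // w wz; apply: he.
apply: le_lt_trans wz; rewrite (_ : (fun x => _) = linfun_of (w - z)).
  exact: linfun_norm_le.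
by apply/funext => x; rewrite /linfun_of dotBl.
Qed.

Lemma measurable_H1_continuous (g : 'rV[R]_d -> R) : continuous g ->
  measurable_fun setT (fun h : borelH1 X => g (min_rep h)).
Proof.
move=> cg; apply: (@measurableT_comp _ _ _ (borelH1 X) (borelRd R d) R g setT
  min_rep).
  exact: measurable_continuous.
exact: measurable_min_rep.
Qed.

Lemma measurable_H1_norm : measurable_fun setT (@H1_norm R d X : borelH1 X -> R).
Proof.
rewrite (_ : @H1_norm R d X = fun h => enorm (min_rep h)).
  by apply: measurable_H1_continuous; exact: enorm_continuous.
by apply/funext => h; exact: H1_normE.
Qed.

Lemma measurable_H1_eval (x : X) : measurable_fun setT (fun h :
  borelH1 X => val h x).
Proof.
rewrite (_ : (fun h : borelH1 X => _) = fun h => dot (min_rep h) (val x)).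
  exact: measurable_H1_continuous (@dot_continuous _ _ (val x)).
by apply/funext => h; rewrite min_repE.
Qed.

End H1_geometry.

(** * Positively homogeneous activations *)

Section homogeneous.
Context {R : realType} (sigma : R -> R) (hs : homogeneous1 sigma).

(** Homogeneity makes sigma linear on each half-line, so measurability and linear growth come
    without any regularity assumption. *)
Lemma homogeneous1E u :
  sigma u = Num.max u 0 * sigma 1 + Num.max (- u) 0 * sigma (-1).
Proof.
have s0 : sigma 0 = 0 by have := hs 0 (lexx 0); rewrite !mul0r.
have [u0|u0] := leP 0 u.
  by rewrite max_r ?oppr_le0// mul0r addr0 -hs// mulr1.
rewrite max_l ?oppr_ge0 ?(ltW u0)// mul0r add0r.
by rewrite -hs ?oppr_ge0 ?(ltW u0)// mulrN1 opprK.
Qed.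

Definition homogeneous1_lip : R := `|sigma 1| + `|sigma (-1)|.

Lemma homogeneous1_le u : `|sigma u| <= homogeneous1_lip * `|u|.
Proof.
rewrite {1}homogeneous1E (le_trans (ler_normD _ _))// !normrM mulrDl.
apply: lerD; rewrite mulrC ler_wpM2l//.
  by have [u0|u0] := leP 0 u; rewrite ?normr0.
by have [u0|u0] := leP 0 (- u); rewrite ?normrN ?normr0.
Qed.

Lemma homogeneous1_lip_ge0 : 0 <= homogeneous1_lip.
Proof. by rewrite addr_ge0. Qed.

Lemma measurable_homogeneous1 : measurable_fun setT sigma.
Proof.
rewrite (_ : sigma = fun u => Num.max u 0 * sigma 1 + Num.max (- u) 0 * sigma (-1)).
  by apply: measurable_funD; apply: measurable_funM => //; exact: measurable_maxr.
by apply/funext => u; exact: homogeneous1E.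
Qed.

End homogeneous.

(** * Features and kernels *)

Section integrals.
Context d (T : measurableType d) (R : realType).

(** The factor G is an activation or a feature in the kernel computations, and the amplitude a when
    f is written through mu. *)
Lemma pairing_integral (mu : {measure set T -> \bar R}) (I : Type)
    (F : T -> I -> R) (G : T -> R) (s : seq (R * I)) :
  (forall i, mu.-integrable setT (fun t => (F t i * G t)%:E)) ->
  mu.-integrable setT (fun t => (pairing s (F t) * G t)%:E) /\
  \int[mu]_t (pairing s (F t) * G t) = pairing s (fun i =>
    \int[mu]_t (F t i * G t)).
Proof.
move=> FG; elim: s => [|[a i] s [ints IH]].
  rewrite (_ : (fun t => _) = cst 0); last first.
    by apply/funext => t; rewrite pairing_nil mul0r.
  split; first exact: integrable0.
  rewrite pairing_nil.
  by under eq_Rintegral do rewrite pairing_nil mul0r; rewrite /Rintegral integral0.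
have eq t : pairing ((a, i) :: s) (F t) * G t =
  a * (F t i * G t) + pairing s (F t) * G t.
  by rewrite -cat1s pairing_cat pairing1 mulrDl mulrA.
have ai : mu.-integrable setT (fun t => (a * (F t i * G t))%:E).
  by under eq_fun do rewrite EFinM; apply: integrableZl.
split.
  under eq_fun do rewrite eq EFinD.
  exact: integrableD.
under eq_Rintegral do rewrite eq.
rewrite RintegralD// RintegralZl//; last exact: FG.
by rewrite IH -[in RHS]cat1s pairing_cat pairing1.
Qed.

Lemma Lnorm2_sqrt (mu : {measure set T -> \bar R}) (g : T -> R) (c : R) :
  (\int[mu]_t (g t ^+ 2)%:E = c%:E)%E ->
  Lnorm mu 2%:E (EFin \o g) = (Num.sqrt c)%:E.
Proof.
move=> gc; rewrite unlock /Lnorm.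
under eq_integral => t _.
  rewrite /= powR_mulrn ?normr_ge0// -normrX ger0_norm ?sqr_ge0//.
  over.
rewrite gc poweR_EFin powR12_sqrt// -lee_fin -gc integral_ge0// => t _.
by rewrite lee_fin sqr_ge0.
Qed.

Lemma integral_CauchySchwarz (mu : {measure set T -> \bar R}) (g h :
  T -> R) (a b : R) :
  measurable_fun setT g -> measurable_fun setT h ->
  (\int[mu]_t (g t ^+ 2)%:E = a%:E)%E -> (\int[mu]_t (h t ^+ 2)%:E = b%:E)%E ->
  (\int[mu]_t (`|g t * h t|)%:E <= (Num.sqrt a * Num.sqrt b)%:E)%E.
Proof.
move=> mg mh ga hb; have h2 : (2 : R)^-1 + 2^-1 = 1 by field.
have := @hoelder _ _ _ mu g h 2 2 mg mh ltac:(by []) ltac:(by []) h2.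
by rewrite Lnorm1 (Lnorm2_sqrt ga) (Lnorm2_sqrt hb) -EFinM.
Qed.

Lemma integral_probability_cst (P : probability T R) (c : R) :
  (\int[P]_t c%:E = c%:E)%E.
Proof.
rewrite integral_cst// -[RHS]mule1; congr (_ * _)%E.
exact: probability_setT.
Qed.

End integrals.

Section features.
Context {R : realType} {d : nat} (X : set 'rV[R]_d) (sigma : R -> R).
Hypothesis hs : homogeneous1 sigma.
Implicit Types (s t : seq (R * X)).

(** The element of L^2(nu) behind the kernel combination [kcomb (kappa sigma nu) s]: integrated
    against sigma(h(x)) it gives the value at x, and its squared L^2 norm is the Gram form. *)
Definition feature s (h : borelH1 X) : R := pairing s (fun x => sigma (val h x)).

Lemma measurable_sigma_eval (x : X) :
  measurable_fun setT (fun h : borelH1 X => sigma (val h x)).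
Proof.
apply: (measurableT_comp (measurable_homogeneous1 hs)).
exact: measurable_H1_eval.
Qed.

Lemma measurable_feature s : measurable_fun setT (feature s).
Proof.
by apply: measurable_sum => i; apply: measurable_funM => //;
  exact: measurable_sigma_eval.
Qed.

Context (nu : probability (borelH1 X) R) (kf : kappa_finite sigma nu).

Lemma feature_eval_integral s (x : X) :
  nu.-integrable setT (fun h => (feature s h * sigma (val h x))%:E) /\
  \int[nu]_h (feature s h * sigma (val h x)) = pairing s (kappa sigma nu ^~ x).
Proof. exact: pairing_integral. Qed.

Lemma gram_kappa s t :
  nu.-integrable setT (fun h => (feature s h * feature t h)%:E) /\
  gram (kappa sigma nu) s t = \int[nu]_h (feature s h * feature t h).
Proof.
have h1 x : nu.-integrable setT (fun h => (sigma (val h x) * feature t h)%:E).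
  have [+ _] := feature_eval_integral t x.
  by under eq_fun do rewrite mulrC.
have [i1 e1] := pairing_integral s h1; split => //.
rewrite /feature e1 /gram; congr pairing; apply/funext => x.
under eq_Rintegral do rewrite mulrC.
rewrite (feature_eval_integral t x).2; congr pairing; apply/funext => y.
by rewrite /kappa; apply: eq_Rintegral => h _; rewrite mulrC.
Qed.

Lemma gram_kappa_sqr s :
  (\int[nu]_h (feature s h ^+ 2)%:E = (gram (kappa sigma nu) s s)%:E)%E.
Proof.
have [i e] := gram_kappa s s; rewrite e /Rintegral fineK; last first.
  exact: integrable_fin_num.
by apply: eq_integral => h _; rewrite expr2.
Qed.

Lemma kappa_psd : psd_kernel (kappa sigma nu).
Proof.
split=> [x y|s]; first by apply: eq_Rintegral => h _; rewrite mulrC.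
rewrite -lee_fin -gram_kappa_sqr; apply: integral_ge0 => h _.
by rewrite lee_fin sqr_ge0.
Qed.

End features.

Section barron_to_ladder.
Context {R : realType} {d : nat} (X : set 'rV[R]_d) (sigma : R -> R).
Hypothesis hs : homogeneous1 sigma.
Local Notation W := (measurableTypeR R * borelRd R d)%type.

Lemma measurable_dot_snd (x : 'rV[R]_d) : measurable_fun setT (fun w :
  W => dot w.2 x).
Proof.
apply: (@measurableT_comp _ _ _ W (borelRd R d) R (fun z => dot z x) setT snd).
  by apply: measurable_continuous; exact: dot_continuous.
exact: measurable_snd.
Qed.

Lemma measurable_enorm_snd : measurable_fun setT (fun w : W => enorm w.2).
Proof.
apply: (@measurableT_comp _ _ _ W (borelRd R d) R (@enorm R d) setT snd).
  by apply: measurable_continuous; exact: enorm_continuous.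
exact: measurable_snd.
Qed.

Lemma measurable_cost : measurable_fun setT (fun w : W => `|w.1| * enorm w.2).
Proof.
apply: measurable_funM; last exact: measurable_enorm_snd.
by apply: measurableT_comp => //; exact: measurable_fst.
Qed.

Lemma H1_moment_le1 (p : \bar R) (nu : probability (borelH1 X) R) :
  (2%:E <= p)%E -> (\forall h \ae nu, H1_norm h <= 1) -> (H1_moment p nu <= 1)%E.
Proof.
move=> p2 h1; rewrite /H1_moment unlock /Lnorm.
case: p p2 => [r|_|//]; last first.
  case: ifPn => _; last exact: lee01.
  apply/ess_supP; apply: (@filterS _ _ (ae_filter_ringOfSetsType nu) _ _ _ h1)
    => h {}h1.
  by rewrite /= lee_fin ger0_norm// H1_normE enorm_ge0.
rewrite lee_fin => r2; have r0 : 0 < r by rewrite (lt_le_trans _ r2).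
apply: (@le_trans _ _ (1 `^ r^-1)%E); last by rewrite poweR_EFin powR1.
have mn : measurable_fun setT (fun h : borelH1 X => (`|H1_norm h| `^ r)%:E).
  apply/measurable_EFinP; apply: (measurableT_comp (measurable_powR r)).
  by apply: measurableT_comp => //; exact: measurable_H1_norm.
apply: gt0_ler_poweR.
- by rewrite invr_ge0 ltW.
- by rewrite in_itv/= leey andbT integral_ge0// => h _; rewrite lee_fin powR_ge0.
- by rewrite in_itv/= leey andbT lee01.
rewrite -[leRHS](_ : \int[nu]_h 1 = 1)%E; last first.
  rewrite integral_cst// mul1e; exact: probability_setT.
apply: ae_ge0_le_integral => //.
  by move=> h _; rewrite lee_fin powR_ge0.
apply: (@filterS _ _ (ae_filter_ringOfSetsType nu) _ _ _ h1) => h {}h1 _;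
  rewrite lee_fin.
rewrite (_ : 1 = 1 `^ r); last by rewrite powR1.
apply: ge0_ler_powR; rewrite ?nnegrE//; first exact: ltW.
by rewrite ger0_norm// H1_normE enorm_ge0.
Qed.

End barron_to_ladder.

(** * From Barron representations to RKHSs *)

Section barron_to_ladder.
Context {R : realType} {d : nat} (X : set 'rV[R]_d) (sigma : R -> R).
Hypothesis hs : homogeneous1 sigma.
Local Notation W := (measurableTypeR R * borelRd R d)%type.
Local Notation cost := (fun w : W => `|w.1| * enorm w.2).

Context (f : X -> R) (mu : probability W R).
Hypothesis mu_f : barron_represents sigma f mu.
Context (m : R) (delta : R).
Hypothesis mE : (\int[mu]_w (cost w)%:E = m%:E)%E.
Hypothesis delta0 : 0 < delta.

Let cost0 (w : W) : 0 <= cost w.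
Proof. by rewrite mulr_ge0 ?enorm_ge0. Qed.

Let m0 : 0 <= m.
Proof. by rewrite -lee_fin -mE integral_ge0// => w _; rewrite lee_fin cost0. Qed.

Let b := m + delta.

Let b0 : 0 < b. Proof. by rewrite ltr_wpDl. Qed.

(* Adding [delta] keeps the weight normalizable when the cost vanishes. *)
Let weight (w : W) : R := (cost w + delta) / b.

Let weight_density : prob_density mu weight.
Proof.
have mc : measurable_fun setT (fun w : W => (cost w)%:E).
  apply/measurable_EFinP; exact: measurable_cost.
split.
- by apply: measurable_funM => //; apply: measurable_funD => //;
  exact: measurable_cost.
- by move=> w; rewrite divr_ge0 ?(ltW b0)// addr_ge0 ?cost0 ?(ltW delta0).
transitivity (\int[mu]_w (b^-1%:E * ((cost w)%:E + delta%:E)))%E.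
  by apply: eq_integral => w _; rewrite -EFinD -EFinM /weight mulrC.
rewrite ge0_integralZl//; last 3 first.
- by apply: emeasurable_funD.
- by move=> w _; rewrite -EFinD lee_fin addr_ge0 ?cost0 ?(ltW delta0).
- by rewrite lee_fin invr_ge0 ltW.
rewrite ge0_integralD//; last 2 first.
- by move=> w _; rewrite lee_fin cost0.
- by move=> w _; rewrite lee_fin ltW.
rewrite mE integral_probability_cst -EFinD -EFinM mulVf//.
by rewrite gt_eqF.
Qed.

Let direction (w : W) : borelH1 X := toH1 X (normalize w.2).

Let measurable_direction : measurable_fun setT direction.
Proof.
apply: (@measurableT_comp _ _ _ W (borelRd R d) (borelH1 X)
  (fun z => toH1 X (normalize z)) setT snd); last exact: measurable_snd.
apply: (@measurableT_comp _ _ _ (borelRd R d) (borelRd R d) (borelH1 X)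
  (@toH1 R d X) setT normalize); first exact: measurable_toH1.
exact: measurable_normalize.
Qed.

Let direction_eval w (x : X) : val (direction w) x = dot (normalize w.2) (val x).
Proof. by []. Qed.

Let norm_direction w : H1_norm (direction w) <= 1.
Proof. by rewrite (le_trans (H1_norm_toH1 _ _))// enorm_normalize. Qed.

Lemma ladder_C2_le_cost (p : \bar R) : (2%:E <= p)%E ->
  (ladder_C2 sigma p f <= b%:E)%E.
Proof.
move=> p2.
have [nu hnu] := exists_density_law weight_density measurable_direction.
have [mw w0 w1] := weight_density.
(* [nu] is known only through its integrals, so the exceptional set is measured by integrating its
   indicator. *)
have h1 : \forall h \ae nu, H1_norm h <= 1.
  pose A := [set h : borelH1 X | ~ (H1_norm h <= 1)].
  have mA : measurable A.
    rewrite (_ : A = ~` ((@H1_norm R d X : borelH1 X -> R) @^-1` `]-oo, 1])).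
      apply: measurableC; rewrite -[X in measurable X]setTI.
      by apply: measurable_H1_norm.
    by apply/seteqP; split=> h /=; rewrite /A/= in_itv/=.
  exists A; split => //.
  have -> : nu A = (\int[nu]_h (\1_A h)%:E)%E by rewrite integral_indic// setIT.
  rewrite hnu; last by apply/measurable_EFinP; exact: measurable_indic.
  apply: integral0_eq => w _; rewrite indicE memNset ?mul0e//.
  by move=> /(_ (norm_direction w)).
(* A bound along the directions suffices, since [nu] is their law. *)
have bounded_integrable (G : borelH1 X -> R) (C : R) : measurable_fun setT G ->
    (forall w, `|G (direction w)| <= C) -> nu.-integrable setT (fun h => (G h)%:E).
  move=> mG GC; have mEG : measurable_fun setT (fun h : borelH1 X => (G h)%:E).
    exact/measurable_EFinP.
  apply/integrableP; split => //.
  rewrite hnu; last exact: measurableT_comp.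
  apply: (@le_lt_trans _ _ (\int[mu]_w (C%:E * (weight w)%:E))%E).
    apply: ge0_le_integral => //.
    - by move=> w _; rewrite -EFinM lee_fin mulr_ge0.
    - apply: emeasurable_funM; last exact/measurable_EFinP.
      apply: (@measurableT_comp _ _ _ W (borelH1 X) (\bar R) (fun h =>
        `|(G h)%:E|%E)) => //.
      exact: measurableT_comp.
    - by apply: emeasurable_funM => //; exact/measurable_EFinP.
    - by move=> w _; rewrite -!EFinM lee_fin ler_wpM2r.
  rewrite integralZl//; first by rewrite w1 mule1 ltry.
  apply/integrableP; split; first exact/measurable_EFinP.
  by under eq_integral do rewrite gee0_abs ?lee_fin//; rewrite w1 ltry.
have eval_le w (x : X) :
    `|sigma (val (direction w) x)| <= homogeneous1_lip sigma * enorm (val x).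
  apply: le_trans (homogeneous1_le hs _) _.
  rewrite ler_wpM2l ?homogeneous1_lip_ge0// direction_eval.
  apply: le_trans (dot_CauchySchwarz _ _) _.
  by rewrite ler_piMl ?enorm_ge0// enorm_normalize.
have kf : kappa_finite sigma nu.
  move=> x x'; apply: (bounded_integrable (fun h =>
    sigma (val h x) * sigma (val h x'))).
    by apply: measurable_funM; exact: measurable_sigma_eval.
  by move=> w; rewrite normrM; apply: ler_pM => //; exact: eval_le.
(* Cauchy-Schwarz against the constant 1, which has L^2 norm 1 under a probability measure. *)
have feature_L1 s : (\int[nu]_h `|(feature sigma s h)%:E|
    <= (Num.sqrt (gram (kappa sigma nu) s s))%:E)%E.
  have m1 : measurable_fun setT (cst 1 : borelH1 X -> R) by exact: measurable_cst.
  have := integral_CauchySchwarz (measurable_feature hs s) m1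
    (gram_kappa_sqr kf s).
  move=> /(_ 1); rewrite sqrtr1 mulr1 => le1.
  apply: le_trans (le1 _); last first.
    by under eq_integral do rewrite expr1n; exact: integral_probability_cst.
  by under [leRHS]eq_integral do rewrite mulr1.
pose H := kernel_rkhs (kappa_psd kf).
have [Hf normf] : rkhs_mem H f /\ rkhs_norm H f <= b.
  apply: kernel_rkhs_norm_le; first exact: ltW.
  move=> s.
  pose F (w : W) (x : X) := sigma (dot w.2 (val x)).
  have Fi x : mu.-integrable setT (fun w : W => (F w x * w.1)%:E).
    have [+ _] := mu_f x; apply: eq_integrable => // w _.
    by rewrite /F mulrC.
  have [Fsi Fse] := pairing_integral s Fi.
  have -> : f = fun x => \int[mu]_w (F w x * w.1).
    apply/funext => x; have [_ fx] := mu_f x.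
    rewrite /Rintegral -[f x]/(fine (f x)%:E) -fx; congr fine.
    by apply: eq_integral => w _; rewrite /F mulrC.
  (* Here 1-homogeneity acts: the length of z leaves sigma, also when z = 0. *)
  have FE w : pairing s (F w) = enorm w.2 * feature sigma s (direction w).
    rewrite /feature -pairingZ; congr pairing; apply/funext => x.
    by rewrite direction_eval -hs ?enorm_ge0// -dotZl normalizeK.
  rewrite -Fse -lee_fin.
  apply: (@le_trans _ _ (\int[mu]_w `|(pairing s (F w) * w.1)%:E|)%E).
    rewrite EFin_normr_Rintegral//; apply: le_abse_integral => //.
    exact: measurable_int Fsi.
  have mfeat : measurable_fun setT (fun h => `|(feature sigma s h)%:E|)%E.
    by apply: measurableT_comp => //; apply/measurable_EFinP;
      exact: measurable_feature.
  apply: (@le_trans _ _ (b%:E * \int[nu]_h `|(feature sigma s h)%:E|)%E).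
    rewrite hnu// -ge0_integralZl//; last 3 first.
    - apply: emeasurable_funM; last exact/measurable_EFinP.
      exact: (@measurableT_comp _ _ _ W (borelH1 X) (\bar R) (fun h =>
        `|(feature sigma s h)%:E|%E)).
    - by move=> w _; rewrite -EFinM lee_fin mulr_ge0.
    - by rewrite lee_fin ltW.
    apply: ge0_le_integral => //.
    - by apply: measurableT_comp => //; exact: measurable_int Fsi.
    - apply: emeasurable_funM => //; apply: emeasurable_funM;
      last exact/measurable_EFinP.
      exact: (@measurableT_comp _ _ _ W (borelH1 X) (\bar R) (fun h =>
        `|(feature sigma s h)%:E|%E)).
    (* The weight times b is |a| ||z|| + delta, which dominates |a| ||z||. *)
    move=> w _; rewrite -!EFinM lee_fin FE /weight mulrCA [b * _]mulrC divfK
      ?gt_eqF//.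
    rewrite !normrM (ger0_norm (enorm_ge0 _)) -mulrA mulrCA ler_wpM2l//.
    by rewrite mulrC lerDl ltW.
  by rewrite EFinM lee_wpmul2l ?lee_fin ?(ltW b0).
have Hk : has_kernel H (kappa sigma nu) by exact: kernel_rkhs_has_kernel.
have D2 : (ladder_D2 sigma p H <= 1)%E.
  apply: le_trans (H1_moment_le1 p2 h1).
  by apply: ereal_inf_lbound; exists nu.
apply: (@le_trans _ _ ((rkhs_norm H f)%:E * ladder_D2 sigma p H)%E).
  apply: ereal_inf_lbound; exists H => //; split => //.
  by rewrite (le_lt_trans D2)// ltry.
rewrite -[leRHS]mule1; apply: lee_pmul => //.
- by rewrite lee_fin rkhs_norm_ge0.
- by apply: le_ereal_inf_tmp => _ [nu' _ <-]; exact: Lnorm_ge0.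
Qed.

End barron_to_ladder.

Lemma ladder_C2_le_barron {R : realType} {d : nat} (X : set 'rV[R]_d)
    (sigma : R -> R) (f : X -> R) (p : \bar R) :
  homogeneous1 sigma -> (2%:E <= p)%E ->
  (ladder_C2 sigma p f <= barron_norm sigma f)%E.
Proof.
move=> hs p2; apply: le_ereal_inf_tmp => _ [mu mu_f <-].
set M := (\int[mu]_w _)%E.
have M0 : (0 <= M)%E.
  by apply: integral_ge0 => w _; rewrite lee_fin mulr_ge0 ?enorm_ge0.
have [->|Moo] := eqVneq M +oo%E; first exact: leey.
have mE : M = (fine M)%:E by rewrite fineK// ge0_fin_numE// ltey.
rewrite mE; apply/lee_addgt0Pr => e e0.
by rewrite -EFinD; exact: (ladder_C2_le_cost hs mu_f mE e0 p2).
Qed.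

(** * From RKHSs to Barron representations *)

(** Lyapunov's inequality: for finite p > 2, Hölder applied to |f|^2 and 1; for p = +oo, an almost
    everywhere bound. *)
Lemma Lnorm2_le_Lnorm d (T : measurableType d) (R : realType) (P : probability T R)
    (f : T -> R) (p : \bar R) : measurable_fun setT f -> (2%:E <= p)%E ->
  (Lnorm P 2%:E (EFin \o f) <= Lnorm P p (EFin \o f))%E.
Proof.
move=> mf; have mfr r : measurable_fun setT (fun x => `|f x| `^ r).
  by apply: (measurableT_comp (measurable_powR r)); exact: measurableT_comp.
have int_ge0 r : (0 <= \int[P]_x (`|f x| `^ r)%:E)%E.
  by apply: integral_ge0 => x _; rewrite lee_fin powR_ge0.
have sqrt_le (N : \bar R) :
  (0 <= N)%E -> (\int[P]_x (`|f x| `^ 2)%:E <= N `^ 2)%E ->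
    (Lnorm P 2%:E (EFin \o f) <= N)%E.
  move=> N0 h; rewrite unlock /Lnorm/=.
  rewrite [leRHS](_ : N = (N `^ 2) `^ 2^-1)%E; last first.
    by rewrite -poweRrM mulfV// poweRe1.
  by apply: gt0_ler_poweR => //; rewrite in_itv/= leey andbT// poweR_ge0.
case: p => [r|_|//]; last first.
  have [->|Noo] := eqVneq (Lnorm P +oo%E (EFin \o f)) +oo%E; first exact: leey.
  apply: sqrt_le; first exact: Lnorm_ge0.
  have Nfin : (Lnorm P +oo%E (EFin \o f)) \is a fin_num.
    by rewrite ge0_fin_numE ?Lnorm_ge0// ltey.
  set M := fine (Lnorm P +oo%E (EFin \o f)).
  have NM : Lnorm P +oo%E (EFin \o f) = M%:E by rewrite fineK.
  have M0 : 0 <= M by rewrite fine_ge0// Lnorm_ge0.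
  rewrite NM poweR_EFin -(integral_probability_cst P (M `^ 2)).
  apply: ae_ge0_le_integral => //; first exact/measurable_EFinP.
    by move=> x _; rewrite lee_fin powR_ge0.
  have PT : (0 < P setT)%E by rewrite [P setT](probability_setT P) lte01.
  have le_ae : \forall x \ae P, (`|(f x)%:E| <= M%:E)%E.
    apply/ess_supP; rewrite -NM unlock /Lnorm; by rewrite PT.
  apply: (@filterS _ _ (ae_filter_ringOfSetsType P) _ _ _ le_ae) => x h _.
  by rewrite lee_fin ge0_ler_powR// nnegrE.
rewrite lee_fin le_eqVlt => /predU1P[<-//|r2].
have r0 : 0 < r by rewrite (lt_trans _ r2).
(* With p = 2 split off, q > 1 and the conjugate exponent is finite and positive. *)
pose q := r / 2; pose q' := (1 - q^-1)^-1.
have q1 : 1 < q by rewrite /q ltr_pdivlMr// mul1r.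
have q0 : 0 < q by rewrite (lt_trans _ q1).
have q'0 : 0 < q' by rewrite invr_gt0 subr_gt0 invf_lt1.
have qq' : q^-1 + q'^-1 = 1 by rewrite invrK addrC subrK.
apply: sqrt_le; first exact: Lnorm_ge0.
have m1 : measurable_fun setT (cst 1 : T -> R) by exact: measurable_cst.
have := @hoelder _ _ _ P (fun x => `|f x| `^ 2) (cst 1) q q' (mfr 2) m1 q0 q'0 qq'.
rewrite Lnorm1 unlock /Lnorm/=.
under [leLHS]eq_integral do rewrite mulr1 ger0_norm ?powR_ge0//.
have q2 : 2 * q = r by rewrite /q mulrC divfK.
under [X in (X `^ q^-1)%E]eq_integral do rewrite ger0_norm ?powR_ge0// -powRrM q2.
under [X in (X `^ q'^-1)%E]eq_integral do rewrite normr1 powR1.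
rewrite integral_probability_cst poweR1r mule1 => /le_trans; apply.
by rewrite -poweRrM /q invf_div mulrC.
Qed.

Section barron_series.
Context {R : realType} {d : nat} (X : set 'rV[R]_d) (sigma : R -> R).
Hypothesis hs : homogeneous1 sigma.
Context d' (T : measurableType d') (P : probability T R).
Context (z : T -> borelRd R d) (mz : measurable_fun setT z).
Context (g : nat -> T -> R) (mg : forall n, measurable_fun setT (g n)).
Context (c : nat -> R) (B : R).
Hypothesis cost_le : forall n, (\int[P]_t (`|g n t| * enorm (z t))%:E <=
  (c n)%:E)%E.
Hypothesis sum_le : forall N, \sum_(0 <= n < N) c n <= B.

Local Notation W := (measurableTypeR R * borelRd R d)%type.

Lemma nneseries_le_bound (u : nat -> \bar R) : (forall n, 0 <= u n)%E ->
  (forall n, u n <= (c n)%:E)%E -> (\sum_(n <oo) u n <= B%:E)%E.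
Proof.
move=> u0 uc; apply: lime_le; first exact: is_cvg_nneseries.
apply: nearW => N; apply: (@le_trans _ _ (\sum_(0 <= n < N) (c n)%:E)%E).
  exact: lee_sum.
by rewrite sumEFin lee_fin.
Qed.

(** The cost bound alone makes the mixture a representation: |a sigma(z . x)| <= L(x) |a| ||z||, so
    the absolute integrals sum to at most L(x) B. *)
Lemma barron_le_series (f : X -> R) :
  (forall x : X, (fun N => \sum_(0 <= n < N)
     \int[P]_t (g n t * sigma (dot (z t) (val x)))) @ \oo --> f x) ->
  (barron_norm sigma f <= B%:E)%E.
Proof.
move=> gf.
have scale_gt0 n : 0 < 2 ^+ n.+1 :> R by rewrite exprn_gt0.
(* The factor 2^(n+1) cancels the mixture weight 2^-(n+1), in the represented value as well as in
   the cost. *)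
pose atom n (t : T) : W := (2 ^+ n.+1 * g n t, z t).
have matom n : measurable_fun setT (atom n).
  by apply/measurable_fun_pair => //; apply: measurable_funM.
have [Q hQ] := choice (fun n => exists_law P (matom n)).
pose L (x : X) := homogeneous1_lip sigma * enorm (val x).
have L0 x : 0 <= L x by rewrite mulr_ge0 ?homogeneous1_lip_ge0 ?enorm_ge0.
have sigma_le (y : 'rV[R]_d) (x : X) : `|sigma (dot y (val x))| <= L x * enorm y.
  apply: le_trans (homogeneous1_le hs _) _.
  rewrite -mulrA ler_wpM2l ?homogeneous1_lip_ge0// mulrC.
  exact: dot_CauchySchwarz.
have mnz : measurable_fun setT (fun t => enorm (z t)).
  apply: (@measurableT_comp _ _ _ T (borelRd R d) R (@enorm R d) setT z) => //.
  by apply: measurable_continuous; exact: enorm_continuous.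
have mcost n : measurable_fun setT (fun t => (`|g n t| * enorm (z t))%:E).
  by apply/measurable_EFinP; apply: measurable_funM => //; exact: measurableT_comp.
have mgs n (x : X) : measurable_fun setT (fun t =>
  g n t * sigma (dot (z t) (val x))).
  apply: measurable_funM => //;
    apply: (measurableT_comp (measurable_homogeneous1 hs)).
  apply: (@measurableT_comp _ _ _ T (borelRd R d) R (fun y =>
    dot y (val x)) setT z) => //.
  by apply: measurable_continuous; exact: dot_continuous.
have mgsE n (x : X) : measurable_fun setT
    (fun t => `|(g n t * sigma (dot (z t) (val x)))%:E|)%E.
  by apply: measurableT_comp => //; apply/measurable_EFinP; exact: mgs.
have mphi (x : X) : measurable_fun setT (fun w :
  W => w.1 * sigma (dot w.2 (val x))).
  apply: measurable_funM; first exact: measurable_fst.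
  apply: (measurableT_comp (measurable_homogeneous1 hs)).
  exact: measurable_dot_snd.
have cost_int n : P.-integrable setT (fun t => (`|g n t| * enorm (z t))%:E).
  apply/integrableP; split => //; apply: (@le_lt_trans _ _ (c n)%:E);
    last exact: ltry.
  apply: le_trans (cost_le n); apply: ge0_le_integral => //.
    exact: measurableT_comp.
  by move=> t _; rewrite gee0_abs// lee_fin mulr_ge0 ?enorm_ge0.
have gs_le n (x : X) t : `|g n t * sigma (dot (z t) (val x))| <=
    L x * (`|g n t| * enorm (z t)).
  by rewrite normrM mulrCA ler_wpM2l.
have gs_int n (x : X) :
  P.-integrable setT (fun t => (g n t * sigma (dot (z t) (val x)))%:E).
  apply: (@le_integrable _ _ _ _ _ measurableT _ (fun t =>
    ((L x)%:E * (`|g n t| * enorm (z t))%:E)%E)).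
  - exact/measurable_EFinP.
  - move=> t _; rewrite -EFinM /= lee_fin.
    by rewrite (le_trans (gs_le n x t))// ler_norm.
  - exact: integrableZl.
have unscale n (y : \bar R) : (((2^-1) ^+ n.+1)%:E * ((2 ^+ n.+1)%:E * y) = y)%E.
  by rewrite muleA -EFinM -exprMn mulVf// expr1n mul1e.
have mix_abs n (x : X) : (((2^-1) ^+ n.+1)%:E *
      \int[Q n]_w `|(w.1 * sigma (dot w.2 (val x)))%:E| =
    \int[P]_t `|(g n t * sigma (dot (z t) (val x)))%:E|)%E.
  rewrite hQ; last by apply: measurableT_comp => //; exact/measurable_EFinP.
  rewrite -[RHS](unscale n); congr (_ * _)%E; rewrite -ge0_integralZl//.
  apply: eq_integral => t _ /=.
  by rewrite -mulrA normrM (gtr0_norm (scale_gt0 n)) EFinM.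
have mix n (x : X) : (((2^-1) ^+ n.+1)%:E *
      \int[Q n]_w (w.1 * sigma (dot w.2 (val x)))%:E =
    (\int[P]_t (g n t * sigma (dot (z t) (val x))))%:E)%E.
  rewrite hQ; last exact/measurable_EFinP.
  rewrite -[RHS](unscale n); congr (_ * _)%E.
  rewrite /Rintegral fineK; last exact: integrable_fin_num.
  rewrite -integralZl//; apply: eq_integral => t _ /=.
  by rewrite -mulrA EFinM.
have mix_cost n : (((2^-1) ^+ n.+1)%:E * \int[Q n]_w (`|w.1| * enorm w.2)%:E =
    \int[P]_t (`|g n t| * enorm (z t))%:E)%E.
  rewrite hQ; last by apply/measurable_EFinP; exact: measurable_cost.
  rewrite -[RHS](unscale n); congr (_ * _)%E; rewrite -ge0_integralZl//; last first.
    by move=> t _; rewrite lee_fin mulr_ge0 ?enorm_ge0.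
  apply: eq_integral => t _ /=.
  by rewrite normrM (gtr0_norm (scale_gt0 n)) -mulrA EFinM.
have rep : barron_represents sigma f (geometric_mixture Q).
  move=> x /=; have [|i ->] := integral_mixture (P := Q) (mphi x).
    apply: (@le_lt_trans _ _ ((L x)%:E * B%:E)%E); last by rewrite -EFinM ltry.
    apply: (@le_trans _ _ (\sum_(n <oo) ((L x)%:E * \int[P]_t (`|g n t| * enorm
      (z t))%:E))%E).
      apply: lee_nneseries => [n _ _|n _].
        by rewrite mix_abs integral_ge0.
      rewrite mix_abs -ge0_integralZl ?lee_fin//; last first.
        by move=> t _; rewrite lee_fin mulr_ge0 ?enorm_ge0.
      apply: ge0_le_integral => //.
      - by apply: emeasurable_funM.
      - by move=> t _; rewrite -EFinM lee_fin.
    have I0 n : (0 <= \int[P]_t (`|g n t| * enorm (z t))%:E)%E.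
      by apply: integral_ge0 => t _; rewrite lee_fin mulr_ge0 ?enorm_ge0.
    rewrite nneseriesZl//.
    by rewrite lee_wpmul2l ?lee_fin// nneseries_le_bound.
  split=> //; under eq_eseriesr do rewrite mix.
  apply/cvg_lim => //; under eq_fun do rewrite sumEFin.
  by apply: cvg_EFin; [exact: nearW|exact: gf].
apply: (@le_trans _ _ (\int[geometric_mixture Q]_w (`|w.1| * enorm w.2)%:E)%E).
  by apply: ereal_inf_lbound; exists (geometric_mixture Q).
rewrite ge0_integral_mixture; last 2 first.
- by apply/measurable_EFinP; exact: measurable_cost.
- by move=> w; rewrite lee_fin mulr_ge0 ?enorm_ge0.
apply: nneseries_le_bound => n; rewrite mix_cost//.
by apply: integral_ge0 => t _; rewrite lee_fin mulr_ge0 ?enorm_ge0.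
Qed.

End barron_series.

(** * Absolutely convergent kernel expansions *)

Section kernel_expansion.
Context {R : realType} {T : Type} (H : rkhs R T) (k : T -> T -> R).
Hypothesis Hk : has_kernel H k.
Context (f : T -> R) (fm : rkhs_mem H f) (e : R) (e0 : 0 < e).

Lemma kcomb_norm s : rkhs_norm H (kcomb k s) = Num.sqrt (gram k s s).
Proof. by rewrite /rkhs_norm (ip_kcomb2 Hk). Qed.

(* The terms are consecutive differences of a fast approximating sequence. *)
Lemma kernel_expansion : exists s : nat -> seq (R * T),
  (forall x, (fun N => \sum_(0 <= n < N) kcomb k (s n) x) @ \oo --> f x) /\
  (forall N, \sum_(0 <= n < N) Num.sqrt (gram k (s n) (s n)) <=
    rkhs_norm H f + 8 * e).
Proof.
pose r (n : nat) : R := e * 2^-1 ^+ n.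
have r0 n : 0 < r n by rewrite mulr_gt0// exprn_gt0// invr_gt0.
have rS n : r n.+1 = r n / 2 by rewrite /r exprSr mulrA.
have [t ht] := choice (fun n => kcomb_dense Hk fm (r0 n)).
have tm n : rkhs_mem H (fun x => f x - kcomb k (t n) x).
  by apply: rkhs_memB => //; exact: kcomb_mem Hk _.
pose s n := if n is n'.+1 then t n ++ scaleseq (-1) (t n') else t 0%N.
have sE n x : kcomb k (s n.+1) x = kcomb k (t n.+1) x - kcomb k (t n) x.
  by rewrite /kcomb /s pairing_cat pairing_scale mulN1r.
have s_sum N x : \sum_(0 <= n < N.+1) kcomb k (s n) x = kcomb k (t N) x.
  elim: N => [|N IH]; first by rewrite big_nat1.
  by rewrite big_nat_recr//= IH sE addrC subrK.
have norm0 : Num.sqrt (gram k (s 0%N) (s 0%N)) <= rkhs_norm H f + r 0%N.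
  rewrite -kcomb_norm; apply: le_trans (_ :
    _ <= rkhs_norm H f + rkhs_norm H (fun x => f x - kcomb k (t 0%N) x)) _.
    apply: le_trans (rkhs_normB_le fm (tm 0%N)); rewrite le_eqVlt; apply/orP; left.
    by apply/eqP; congr rkhs_norm; apply/funext => x /=; ring.
  by rewrite lerD2l.
have normS n : Num.sqrt (gram k (s n.+1) (s n.+1)) <= r n + r n.+1.
  rewrite -kcomb_norm (_ : kcomb k (s n.+1) =
    (fun x => (f x - kcomb k (t n) x) - (f x - kcomb k (t n.+1) x))).
    by apply: le_trans (rkhs_normB_le (tm n) (tm n.+1)) _; rewrite lerD.
  by apply/funext => x; rewrite sE; ring.
exists s; split=> [x|N].
  rewrite -cvg_shiftS; under eq_fun do rewrite s_sum.
  have [C hC] := rkhs_eval H x.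
  have C1 : 0 < `|C| + 1 by rewrite ltr_wpDl.
  have rcvg : r @ \oo --> (0 : R).
    by apply: cvg_geometric; rewrite ger0_norm ?invr_ge0// invf_lt1// ltr1n.
  apply/cvgrPdist_le => a a0.
  move/cvgrPdist_le : rcvg => /(_ (a / (`|C| + 1))); rewrite divr_gt0// => /(_ isT).
  apply: filterS => n; rewrite sub0r normrN ger0_norm ?(ltW (r0 n))// => rn.
  apply: le_trans (hC _ (tm n)) _.
  have CC : C <= `|C| + 1 by rewrite (le_trans (ler_norm _))// lerDl.
  apply: le_trans (ler_wpM2r (rkhs_norm_ge0 _ _) CC) _.
  rewrite mulrC -ler_pdivlMr//; exact: le_trans (ht n) rn.
case: N => [|N].
  by rewrite big_nil addr_ge0 ?rkhs_norm_ge0// mulr_ge0// ltW.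
(* A telescoping bound suited to induction: passing from N to N + 1 adds a term of at most r_N +
   r_(N+1) = 3 r_(N+1), while the bound grows by 8 (r_(N+1) - r_(N+2)) = 4 r_(N+1). *)
apply: (@le_trans _ _ (rkhs_norm H f + 8 * (r 0%N - r N.+1))); last first.
  rewrite lerD2l ler_wpM2l// /r expr0 mulr1 gerBl.
  exact: ltW (r0 N.+1).
elim: N => [|N IH].
  by rewrite big_nat1 rS; apply: le_trans norm0 _; have := r0 0%N; lra.
rewrite big_nat_recr//=; apply: le_trans (lerD IH (normS N)) _.
by rewrite !rS; have := r0 N; lra.
Qed.

End kernel_expansion.

Section ladder_to_barron.
Context {R : realType} {d : nat} (X : set 'rV[R]_d) (sigma : R -> R) (f : X -> R).
Hypothesis hs : homogeneous1 sigma.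

Lemma barron_le_moment (p : \bar R) (H : rkhs R X) (nu :
  probability (borelH1 X) R) :
  (2%:E <= p)%E -> kappa_finite sigma nu -> has_kernel H (kappa sigma nu) ->
  rkhs_mem H f -> (H1_moment p nu < +oo)%E ->
  (barron_norm sigma f <= (rkhs_norm H f)%:E * H1_moment p nu)%E.
Proof.
move=> p2 kf Hk fm nuoo.
have N2 : (Lnorm nu 2%:E (EFin \o (@H1_norm R d X :
  borelH1 X -> R)) <= H1_moment p nu)%E.
  by apply: Lnorm2_le_Lnorm => //; exact: measurable_H1_norm.
have [c cE] : exists c : R, (\int[nu]_h (H1_norm h ^+ 2)%:E = c%:E)%E.
  exists (fine (\int[nu]_h (H1_norm h ^+ 2)%:E)%E);
    rewrite fineK// ge0_fin_numE; last first.
    by apply: integral_ge0 => h _; rewrite lee_fin sqr_ge0.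
  have := le_lt_trans N2 nuoo; rewrite unlock /Lnorm/= => /lty_poweRy.
  rewrite invr_eq0 pnatr_eq0 => /(_ isT); apply: le_lt_trans.
  by under [leRHS]eq_integral do rewrite powR_mulrn// real_normK ?num_real//.
rewrite (Lnorm2_sqrt cE) in N2.
apply: le_trans (_ : _ <= (rkhs_norm H f)%:E * (Num.sqrt c)%:E)%E _; last first.
  by rewrite lee_wpmul2l// lee_fin rkhs_norm_ge0.
rewrite -EFinM; apply/lee_addgt0Pr => e e0; rewrite -EFinD.
(* Chosen so that the excess 8 eps sqrt(c) is at most e; adding 1 covers c = 0. *)
pose eps := e / (8 * (Num.sqrt c + 1)).
have c1 : 0 < Num.sqrt c + 1 by rewrite ltr_wpDl// sqrtr_ge0.
have eps0 : 0 < eps by rewrite divr_gt0// mulr_gt0.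
have [s [sf sB]] := kernel_expansion Hk fm eps0.
(* The base space is [H1 X] under [nu]. Since [min_rep] attains the norm of h, each cost is an
   integral of |g_n| ||h||, and Cauchy-Schwarz applies. *)
apply: (@barron_le_series _ _ X sigma hs _ _ nu (@min_rep R d X)
  (@measurable_min_rep _ _ X)
   (fun n => feature sigma (s n)) (fun n => measurable_feature hs (s n))
   (fun n => Num.sqrt (gram (kappa sigma nu) (s n) (s n)) * Num.sqrt c)
   (rkhs_norm H f * Num.sqrt c + e) _ _ f _).
- move=> n; have := integral_CauchySchwarz (measurable_feature hs (s n))
    (@measurable_H1_norm R d X) (gram_kappa_sqr kf (s n)) cE.
  apply: le_trans; rewrite le_eqVlt; apply/orP; left; apply/eqP.
  apply: eq_integral => h _.
  by rewrite normrM H1_normE (ger0_norm (enorm_ge0 _)).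
- move=> N; rewrite -mulr_suml.
  apply: le_trans (ler_wpM2r (sqrtr_ge0 c) (sB N)) _.
  rewrite mulrDl lerD2l /eps.
  have -> : 8 * (e / (8 * (Num.sqrt c + 1))) * Num.sqrt c =
      e * (Num.sqrt c / (Num.sqrt c + 1)) by field; rewrite gt_eqF.
  by rewrite ler_piMr ?(ltW e0)// ler_pdivrMr// mul1r lerDl.
move=> x.
rewrite (_ : (fun N => _) = fun N =>
  \sum_(0 <= n < N) kcomb (kappa sigma nu) (s n) x).
  exact: sf.
apply/funext => N; apply: eq_bigr => n _;
  rewrite /kcomb -(feature_eval_integral kf (s n) x).2.
by apply: eq_Rintegral => h _; rewrite min_repE.
Qed.

End ladder_to_barron.

Theorem proposition5 (R : realType) (d : nat) (X : set 'rV[R]_d)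
    (sigma : R -> R) (f : X -> R) (p : \bar R) :
  compact X -> homogeneous1 sigma -> (2%:E <= p)%E ->
  barron_norm sigma f = ladder_C2 sigma p f.
Proof.
move=> _ hs p2; apply/eqP; rewrite eq_le ladder_C2_le_barron// andbT.
apply: le_ereal_inf_tmp => _ [H [fm D2oo] <-].
have D2_ge0 : (0 <= ladder_D2 sigma p H)%E.
  by apply: le_ereal_inf_tmp => _ [nu _ <-]; exact: Lnorm_ge0.
have D2fin : (ladder_D2 sigma p H) \is a fin_num by rewrite ge0_fin_numE.
apply/lee_addgt0Pr => e e0.
(* The slack in the infimum gets multiplied by the norm of f; adding 1 covers a zero norm. *)
pose eps := e / (rkhs_norm H f + 1).
have n1 : 0 < rkhs_norm H f + 1 by rewrite ltr_wpDl// rkhs_norm_ge0.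
have eps0 : 0 < eps by rewrite divr_gt0.
have [_ [nu [kf Hk] <-] nuD] := lb_ereal_inf_adherent eps0 D2fin.
have nuoo : (H1_moment p nu < +oo)%E.
  by rewrite (lt_le_trans nuD)// leey.
apply: le_trans (barron_le_moment hs p2 kf Hk fm nuoo) _.
apply: le_trans (lee_wpmul2l _ (ltW nuD)) _; first by rewrite lee_fin rkhs_norm_ge0.
rewrite muleDr//; last by rewrite fin_num_adde_defr.
rewrite leeD2l// -EFinM lee_fin /eps mulrCA ler_piMr ?(ltW e0)//.
by rewrite ler_pdivrMr// mul1r lerDl.
Qed.
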